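(* Let $v\in\mathrm{Int}(\gamma^a)$ and $F,G\in\mathrm{D}(\mathbf{k}_{\mathbb{V}_{\mathfrak{a}}})$. Denote by $d^v_{I_{\mathfrak{a}}}$ (resp. $d^v_{I_\gamma}$) the interleaving distance with respect to $v$ on $\mathrm{D}(\mathbf{k}_{\mathbb{V}_{\mathfrak{a}}})$ (resp. $\mathrm{D}(\mathbf{k}_{\mathbb{V}_\gamma})$). Then $$d^v_{I_{\mathfrak{a}}}(F,G)=d^v_{I_\gamma}(\beta_*F,\beta_*G).$$
   Context: $\mathbf{k}$ is a field and $\mathbb{V}$ is a finite dimensional real vector space. $\gamma\subset\mathbb{V}$ is a closed convex cone ($\mathbb{R}_{>0}\gamma\subset\gamma$) with non-empty interior, and is proper: $\gamma\cap(-\gamma)=\{0\}$. $\gamma^a=-\gamma$, and $\mathrm{Int}$ denotes the interior for the usual topology. $\mathbb{V}_\gamma$ is $\mathbb{V}$ with the $\gamma$-topology: the open sets are the subsets $U$ which are open for the usual topology and satisfy $U+\gamma=U$. $\mathbb{V}_{\mathfrak{a}}$ is $\mathbb{V}$ with the Alexandrov topology: the open sets are all subsets $U$ with $U+\gamma=U$. $\mathrm{Mod}(\mathbf{k}_{X})$ is the category of sheaves of $\mathbf{k}$-modules on $X$ and $\mathrm{D}(\mathbf{k}_X)$ its unbounded derived category. $\beta\colon\mathbb{V}_{\mathfrak{a}}\to\mathbb{V}_\gamma$ is the identity map, which is continuous; the functor $\beta_*$, $(\beta_*F)(U)=F(U)$, is exact on sheaves of $\mathbf{k}$-modules, and the induced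 functor $\mathrm{D}(\mathbf{k}_{\mathbb{V}_{\mathfrak{a}}})\to\mathrm{D}(\mathbf{k}_{\mathbb{V}_\gamma})$ is denoted in the same way. Let $X$ be $\mathbb{V}_{\mathfrak a}$ or $\mathbb{V}_\gamma$. For $v\in\mathbb{V}$ let $\tau_v\colon x\mapsto x-v$ (a homeomorphism of $X$), so that $(\tau_{v*}F)(U)=F(U+v)$ for a sheaf $F$. If $v\in\gamma^a$ then $U\subset U+v$ for every open $U$ of $X$, and the restriction maps $F(U+v)\to F(U)$ define a natural morphism $\tau_{v*}F\to F$; applying this to a homotopically injective resolution gives, for $F\in\mathrm{D}(\mathbf{k}_X)$, a natural morphism $\chi_{v,0}(F)\colon\tau_{v*}F\to F$ in $\mathrm{D}(\mathbf{k}_X)$. $F,G\in\mathrm{D}(\mathbf{k}_X)$ are $v$-interleaved ($v\in\gamma^a$) if there are morphisms $f\colon\tau_{v*}F\to G$ and $g\colon\tau_{v*}G\to F$ in $\mathrm{D}(\mathbf{k}_X)$ with $g\circ\tau_{v*}f=\chi_{2v,0}(F)$ and $f\circ\tau_{v*}g=\chi_{2v,0}(G)$. The interleaving distance with respect to $v\in\gamma^a$ is $\inf(\{c\ge 0\mid F\text{ and }G\text{ are }(c\cdot v)\text{-interleaved}\}\cup\{\infty\})$. *)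

(* Defs.v *)
From HB Require Import structures.
From mathcomp Require Import all_boot all_order all_algebra.
From mathcomp Require Import all_classical all_reals.
From mathcomp Require Import ereal topology normedtype convex.

Set Implicit Arguments.
Unset Strict Implicit.
Unset Printing Implicit Defensive.

Import Order.TTheory GRing.Theory Num.Theory.
Import numFieldTopology.Exports numFieldNormedType.Exports.

Local Open Scope classical_set_scope.
Local Open Scope ring_scope.

(* A module presented by a type of representatives: the module axioms hold up to
   [pm_eqv], and [quotient_module] is the actual module. *)
Record premodule (k : fieldType) := Premodule {
  pm_car :> Type;
  pm_eqv : pm_car -> pm_car -> Prop;
  pm_zero : pm_car;
  pm_add : pm_car -> pm_car -> pm_car;
  pm_scale : k -> pm_car -> pm_car;
  pm_refl : forall x, pm_eqv x x;
  pm_sym : forall x y, pm_eqv x y -> pm_eqv y x;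
  pm_trans : forall x y z, pm_eqv x y -> pm_eqv y z -> pm_eqv x z;
  pm_addP : forall x x' y y', pm_eqv x x' -> pm_eqv y y' ->
    pm_eqv (pm_add x y) (pm_add x' y');
  pm_scaleP : forall a x x', pm_eqv x x' -> pm_eqv (pm_scale a x) (pm_scale a x');
  pm_addA : forall x y z,
    pm_eqv (pm_add x (pm_add y z)) (pm_add (pm_add x y) z);
  pm_addC : forall x y, pm_eqv (pm_add x y) (pm_add y x);
  pm_add0 : forall x, pm_eqv (pm_add pm_zero x) x;
  pm_addN : forall x, pm_eqv (pm_add (pm_scale (-1) x) x) pm_zero;
  pm_scaleA : forall a b x,
    pm_eqv (pm_scale a (pm_scale b x)) (pm_scale (a * b) x);
  pm_scale1 : forall x, pm_eqv (pm_scale 1 x) x;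
  pm_scaleDr : forall a x y,
    pm_eqv (pm_scale a (pm_add x y)) (pm_add (pm_scale a x) (pm_scale a y));
  pm_scaleDl : forall x a b,
    pm_eqv (pm_scale (a + b) x) (pm_add (pm_scale a x) (pm_scale b x)) }.

Definition quotient_module (k : fieldType) (M : premodule k) :=
  {A : set M | exists x, A = [set y | pm_eqv x y]}.

Section QuotientModule.
Variables (k : fieldType) (M : premodule k).
Local Notation Q := (quotient_module M).

Definition class_of (x : M) : Q :=
  exist _ [set y | pm_eqv x y] (ex_intro _ x erefl).

Lemma class_of_eq (x y : M) : class_of x = class_of y <-> pm_eqv x y.
Proof.
split=> [/(congr1 (fun q : Q => sval q y)) /= ->|xy]; first exact: pm_refl.
apply: eq_exist => /=; apply/seteqP; split=> z /=; apply: pm_trans => //.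
exact: pm_sym.
Qed.

Lemma class_of_surj (q : Q) : exists x, q = class_of x.
Proof. by case: q => A [x Ax]; exists x; apply: eq_exist. Qed.

Definition class_repr (q : Q) : M := projT1 (cid (class_of_surj q)).

Lemma class_reprK (q : Q) : class_of (class_repr q) = q.
Proof. by rewrite /class_repr; case: cid. Qed.

Lemma class_repr_eqv (x : M) : pm_eqv (class_repr (class_of x)) x.
Proof. by apply/class_of_eq; rewrite class_reprK. Qed.

Definition quot_add (p q : Q) : Q :=
  class_of (pm_add (class_repr p) (class_repr q)).
Definition quot_scale (a : k) (q : Q) : Q :=
  class_of (pm_scale a (class_repr q)).

Lemma quot_addE x y :
  quot_add (class_of x) (class_of y) = class_of (pm_add x y).
Proof. by apply/class_of_eq/pm_addP; exact: class_repr_eqv. Qed.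

Lemma quot_scaleE a x :
  quot_scale a (class_of x) = class_of (pm_scale a x).
Proof. by apply/class_of_eq/pm_scaleP; exact: class_repr_eqv. Qed.

Lemma quot_addA : associative quot_add.
Proof.
move=> p q r; have [x ->] := class_of_surj p; have [y ->] := class_of_surj q.
have [z ->] := class_of_surj r; rewrite !quot_addE.
exact/class_of_eq/pm_addA.
Qed.

Lemma quot_addC : commutative quot_add.
Proof.
move=> p q; have [x ->] := class_of_surj p; have [y ->] := class_of_surj q.
by rewrite !quot_addE; exact/class_of_eq/pm_addC.
Qed.

Lemma quot_add0 : left_id (class_of (pm_zero M)) quot_add.
Proof.
move=> p; have [x ->] := class_of_surj p; rewrite quot_addE.
exact/class_of_eq/pm_add0.
Qed.

Lemma quot_addN : left_inverse (class_of (pm_zero M)) (quot_scale (-1)) quot_add.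
Proof.
move=> p; have [x ->] := class_of_surj p; rewrite quot_scaleE quot_addE.
exact/class_of_eq/pm_addN.
Qed.

HB.instance Definition _ := gen_eqMixin Q.
HB.instance Definition _ := gen_choiceMixin Q.
HB.instance Definition _ :=
  GRing.isZmodule.Build Q quot_addA quot_addC quot_add0 quot_addN.

Lemma quot_scaleA (a b : k) (q : Q) :
  quot_scale a (quot_scale b q) = quot_scale (a * b) q.
Proof.
have [x ->] := class_of_surj q; rewrite !quot_scaleE.
exact/class_of_eq/pm_scaleA.
Qed.

Lemma quot_scale1 : left_id 1 quot_scale.
Proof.
move=> q; have [x ->] := class_of_surj q; rewrite quot_scaleE.
exact/class_of_eq/pm_scale1.
Qed.

Lemma quot_scaleDr : right_distributive quot_scale +%R.
Proof.
move=> a p q; have [x ->] := class_of_surj p; have [y ->] := class_of_surj q.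
rewrite /GRing.add /= !(quot_addE, quot_scaleE).
exact/class_of_eq/pm_scaleDr.
Qed.

Lemma quot_scaleDl (q : Q) : {morph quot_scale^~ q : a b / a + b}.
Proof.
move=> a b; have [x ->] := class_of_surj q.
rewrite [in RHS]/GRing.add /= !(quot_addE, quot_scaleE).
exact/class_of_eq/pm_scaleDl.
Qed.

HB.instance Definition _ := GRing.Zmodule_isLmodule.Build k Q
  quot_scaleA quot_scale1 quot_scaleDr quot_scaleDl.

Lemma class_ofP (a : k) (x y : M) :
  class_of (pm_add (pm_scale a x) y) = a *: class_of x + class_of y.
Proof. by rewrite -quot_addE -quot_scaleE. Qed.

End QuotientModule.

Record premodule_hom (k : fieldType) (M N : premodule k) := PremoduleHom {
  pmh_fun :> M -> N;
  pmh_eqv : forall x y, pm_eqv x y -> pm_eqv (pmh_fun x) (pmh_fun y);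
  pmh_linear : forall a x y,
    pm_eqv (pmh_fun (pm_add (pm_scale a x) y))
           (pm_add (pm_scale a (pmh_fun x)) (pmh_fun y)) }.

Section QuotientMap.
Variables (k : fieldType) (M N : premodule k) (f : premodule_hom M N).

Definition quotient_map (q : quotient_module M) : quotient_module N :=
  class_of (f (class_repr q)).

Lemma quotient_mapE x : quotient_map (class_of x) = class_of (f x).
Proof. exact/class_of_eq/pmh_eqv/class_repr_eqv. Qed.

Lemma quotient_map_linear : linear quotient_map.
Proof.
move=> a p q; have [x ->] := class_of_surj p; have [y ->] := class_of_surj q.
rewrite -class_ofP !quotient_mapE -class_ofP.
exact/class_of_eq/pmh_linear.
Qed.

HB.instance Definition _ :=
  GRing.isLinear.Build k (quotient_module M) (quotient_module N) *:%R
    quotient_map quotient_map_linear.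

End QuotientMap.

Record opens (X : topologicalType) := Opens {
  oset :> set X;
  opens_open : open oset }.

Definition opensI (X : topologicalType) (U W : opens X) : opens X :=
  Opens (openI (opens_open U) (opens_open W)).

Definition preimage_opens (X Y : topologicalType) (f : X -> Y)
    (cf : continuous f) (U : opens Y) : opens X :=
  Opens ((continuousP f).1 cf _ (opens_open U)).

Lemma opens_ext (X : topologicalType) (U W : opens X) :
  (U : set X) = W -> U = W.
Proof.
case: U W => [U oU] [W oW] /= UW; subst W; congr Opens; exact: Prop_irrelevance.
Qed.

Record presheaf (k : fieldType) (X : topologicalType) := Presheaf {
  sections :> opens X -> lmodType k;
  res : forall U W : opens X, W `<=` U -> {linear sections U -> sections W};
  res_id : forall (U : opens X) (UU : U `<=` U) s, res UU s = s;
  res_comp : forall (U W Z : opens X) (WU : W `<=` U) (ZW : Z `<=` W)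
    (ZU : Z `<=` U) s, res ZW (res WU s) = res ZU s }.
Arguments res {k X p U W}.

Lemma res_irr (k : fieldType) (X : topologicalType) (P : presheaf k X)
    (U W : opens X) (h h' : W `<=` U) (s : P U) : res h s = res h' s.
Proof. by rewrite (Prop_irrelevance h h'). Qed.

Record presheaf_hom (k : fieldType) (X : topologicalType)
    (P Q : presheaf k X) := PresheafHom {
  hom_map :> forall U : opens X, {linear P U -> Q U};
  hom_res : forall (U W : opens X) (WU : W `<=` U) s,
    hom_map W (res WU s) = res WU (hom_map U s) }.

Definition is_isomorphism (k : fieldType) (X : topologicalType)
    (P Q : presheaf k X) (f : presheaf_hom P Q) :=
  exists g : presheaf_hom Q P,
    (forall U s, g U (f U s) = s) /\ (forall U s, f U (g U s) = s).

(* I may be empty, which forces the sections over the empty set to be 0 *)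
Definition is_sheaf (k : fieldType) (X : topologicalType)
    (P : presheaf k X) :=
  forall (I : Type) (U : I -> opens X) (W : opens X)
    (UW : forall i, U i `<=` W), W `<=` \bigcup_i U i ->
  (forall s t : P W, (forall i, res (UW i) s = res (UW i) t) -> s = t) /\
  (forall s : forall i, P (U i),
    (forall i j, res (@subIsetl _ (U i) (U j) : opensI (U i) (U j) `<=` U i) (s i)
               = res (@subIsetr _ (U i) (U j) : opensI (U i) (U j) `<=` U j) (s j)) ->
    exists t : P W, forall i, res (UW i) t = s i).

Record sheaf (k : fieldType) (X : topologicalType) := Sheaf {
  sheaf_presheaf :> presheaf k X;
  sheafP : is_sheaf sheaf_presheaf }.

Section Stalk.
Variables (k : fieldType) (X : topologicalType) (P : presheaf k X) (x : X).

Record local_section := LocalSection {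
  ls_dom : opens X;
  ls_mem : oset ls_dom x;
  ls_sec : P ls_dom }.

Definition same_germ (s t : local_section) :=
  exists (W : opens X) (_ : oset W x) (Ws : W `<=` ls_dom s) (Wt : W `<=` ls_dom t),
    res Ws (ls_sec s) = res Wt (ls_sec t).

Definition ls_zero : local_section :=
  @LocalSection (Opens openT) I 0.

Definition ls_add (s t : local_section) : local_section :=
  @LocalSection (opensI (ls_dom s) (ls_dom t)) (conj (ls_mem s) (ls_mem t))
    (res (@subIsetl _ _ _ : opensI _ _ `<=` ls_dom s) (ls_sec s) +
     res (@subIsetr _ _ _ : opensI _ _ `<=` ls_dom t) (ls_sec t)).

Definition ls_scale (a : k) (s : local_section) : local_section :=
  LocalSection (ls_mem s) (a *: ls_sec s).

Lemma same_germ_refl s : same_germ s s.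
Proof. by exists (ls_dom s), (ls_mem s), (@subset_refl _ _), (@subset_refl _ _). Qed.

Lemma same_germ_sym s t : same_germ s t -> same_germ t s.
Proof. by move=> [W [Wx [Ws [Wt e]]]]; exists W, Wx, Wt, Ws. Qed.

Lemma same_germ_trans s t u : same_germ s t -> same_germ t u -> same_germ s u.
Proof.
move=> [W [Wx [Ws [Wt e]]]] [Z [Zx [Zt [Zu e']]]].
have WZW : opensI W Z `<=` W by move=> ? [].
have WZZ : opensI W Z `<=` Z by move=> ? [].
exists (opensI W Z), (conj Wx Zx), (subset_trans WZW Ws), (subset_trans WZZ Zu).
rewrite -(res_comp Ws WZW) e (res_comp Wt WZW (subset_trans WZW Wt)).
by rewrite -(res_comp Zu WZZ) -e' (res_comp Zt WZZ (subset_trans WZW Wt)).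
Qed.

Lemma same_germ_res (U W : opens X) (Ux : oset U x) (Wx : oset W x) (WU : W `<=` U)
    (s : P U) (t : P W) :
  res WU s = t -> same_germ (LocalSection Ux s) (LocalSection Wx t).
Proof. by move=> e; exists W, Wx, WU, (@subset_refl _ _) => /=; rewrite res_id. Qed.

Lemma same_germ_eq (U : opens X) (Ux : oset U x) (s t : P U) :
  s = t -> same_germ (LocalSection Ux s) (LocalSection Ux t).
Proof. by move=> ->; exact: same_germ_refl. Qed.

Lemma same_germ_add s s' t t' :
  same_germ s s' -> same_germ t t' -> same_germ (ls_add s t) (ls_add s' t').
Proof.
move=> [W [Wx [Ws [Ws' e]]]] [Z [Zx [Zt [Zt' e']]]].
have WZW : opensI W Z `<=` W by move=> ? [].
have WZZ : opensI W Z `<=` Z by move=> ? [].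
have WZst : opensI W Z `<=` opensI (ls_dom s) (ls_dom t).
  by move=> y [/Ws ? /Zt ?].
have WZst' : opensI W Z `<=` opensI (ls_dom s') (ls_dom t').
  by move=> y [/Ws' ? /Zt' ?].
exists (opensI W Z), (conj Wx Zx), WZst, WZst' => /=.
rewrite !linearD /=.
rewrite (res_comp _ WZst (subset_trans WZW Ws)).
rewrite (res_comp _ WZst (subset_trans WZZ Zt)).
rewrite (res_comp _ WZst' (subset_trans WZW Ws')).
rewrite (res_comp _ WZst' (subset_trans WZZ Zt')).
by rewrite -(res_comp Ws WZW) e -(res_comp Zt WZZ) e' (res_comp Ws' WZW (subset_trans WZW Ws'))
  (res_comp Zt' WZZ (subset_trans WZZ Zt')).
Qed.

Lemma same_germ_scale a s s' :
  same_germ s s' -> same_germ (ls_scale a s) (ls_scale a s').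
Proof.
move=> [W [Wx [Ws [Ws' e]]]]; exists W, Wx, Ws, Ws' => /=.
by rewrite !linearZ /= e.
Qed.

Lemma ls_addA s t u :
  same_germ (ls_add s (ls_add t u)) (ls_add (ls_add s t) u).
Proof.
pose W := opensI (ls_dom s) (opensI (ls_dom t) (ls_dom u)).
have W1 : W `<=` ls_dom (ls_add (ls_add s t) u) by move=> ? [? []].
have Ws : W `<=` ls_dom s by move=> ? [? []].
have Wt : W `<=` ls_dom t by move=> ? [? []].
have Wu : W `<=` ls_dom u by move=> ? [? []].
exists W, (conj (ls_mem s) (conj (ls_mem t) (ls_mem u))), (@subset_refl _ _), W1.
rewrite /= res_id !linearD /= !(res_comp _ _ Ws, res_comp _ _ Wt, res_comp _ _ Wu).
have Wst : W `<=` opensI (ls_dom s) (ls_dom t) by move=> ? [? []].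
rewrite !(res_comp _ _ Wst) (res_comp _ _ Ws) (res_comp _ _ Wt) addrA.
by congr (_ + _ + _); exact: res_irr.
Qed.

Lemma ls_addC s t : same_germ (ls_add s t) (ls_add t s).
Proof.
pose W := opensI (ls_dom s) (ls_dom t).
have W1 : W `<=` ls_dom (ls_add t s) by move=> ? [].
have Ws : W `<=` ls_dom s by move=> ? [].
have Wt : W `<=` ls_dom t by move=> ? [].
exists W, (conj (ls_mem s) (ls_mem t)), (@subset_refl _ _), W1.
rewrite /= res_id !linearD /= (res_comp _ _ Ws) (res_comp _ _ Wt) addrC.
by congr (_ + _); exact: res_irr.
Qed.

Lemma ls_add0 s : same_germ (ls_add ls_zero s) s.
Proof.
have W1 : ls_dom s `<=` ls_dom (ls_add ls_zero s) by move=> ? ?.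
exists (ls_dom s), (ls_mem s), W1, (@subset_refl _ _) => /=.
by rewrite linearD /= !linear0 add0r (res_comp _ _ (@subset_refl _ _)).
Qed.

Lemma ls_addN s : same_germ (ls_add (ls_scale (-1) s) s) ls_zero.
Proof.
have W1 : ls_dom s `<=` ls_dom (ls_add (ls_scale (-1) s) s) by move=> ? ?.
have W2 : ls_dom s `<=` ls_dom s := @subset_refl _ _.
exists (ls_dom s), (ls_mem s), W1, (@subsetT _ _) => /=.
by rewrite !linearD /= !linear0 !(res_comp _ _ W2) linearZ /= res_id scaleN1r addNr.
Qed.

Lemma ls_scaleA a b s :
  same_germ (ls_scale a (ls_scale b s)) (ls_scale (a * b) s).
Proof.
by rewrite /ls_scale /=; apply: same_germ_eq; rewrite scalerA.
Qed.

Lemma ls_scale1 s : same_germ (ls_scale 1 s) s.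
Proof.
case: s => U Ux s.
by rewrite /ls_scale /=; apply: same_germ_eq; rewrite scale1r.
Qed.

Lemma ls_scaleDr a s t :
  same_germ (ls_scale a (ls_add s t)) (ls_add (ls_scale a s) (ls_scale a t)).
Proof.
by rewrite /ls_scale /ls_add /=; apply: same_germ_eq; rewrite scalerDr /= !linearZ.
Qed.

Lemma ls_scaleDl s a b :
  same_germ (ls_scale (a + b) s) (ls_add (ls_scale a s) (ls_scale b s)).
Proof.
have W1 : ls_dom s `<=` ls_dom (ls_add (ls_scale a s) (ls_scale b s)) by [].
have W2 : ls_dom s `<=` ls_dom s := @subset_refl _ _.
exists (ls_dom s), (ls_mem s), W2, W1.
by rewrite /= linearD /= !(res_comp _ _ W2) !res_id scalerDl.
Qed.

Definition germ_premodule : premodule k :=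
  Premodule same_germ_refl same_germ_sym same_germ_trans same_germ_add
    same_germ_scale ls_addA ls_addC ls_add0 ls_addN ls_scaleA ls_scale1
    ls_scaleDr ls_scaleDl.

Definition stalk : lmodType k := quotient_module germ_premodule.

Definition germ (U : opens X) (Ux : oset U x) (s : P U) : stalk :=
  @class_of k germ_premodule (LocalSection Ux s).

Lemma germ_eq (U W : opens X) (Ux : oset U x) (Wx : oset W x) (s : P U) (t : P W) :
  germ Ux s = germ Wx t <->
  exists (Z : opens X) (_ : oset Z x) (ZU : Z `<=` U) (ZW : Z `<=` W),
    res ZU s = res ZW t.
Proof. exact: class_of_eq. Qed.

Lemma germ_surj (q : stalk) :
  exists (U : opens X) (Ux : oset U x) (s : P U), q = germ Ux s.
Proof. by have [[U Ux s] ->] := class_of_surj q; exists U, Ux, s. Qed.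

Lemma germ_res (U W : opens X) (Ux : oset U x) (Wx : oset W x) (WU : W `<=` U) (s : P U) :
  germ Wx (res WU s) = germ Ux s.
Proof. exact/esym/class_of_eq/same_germ_res. Qed.

Lemma germP (U : opens X) (Ux : oset U x) a (s t : P U) :
  germ Ux (a *: s + t) = a *: germ Ux s + germ Ux t.
Proof.
rewrite /germ -class_ofP; apply/class_of_eq.
have W1 : U `<=` opensI U U by [].
exists U, Ux, (@subset_refl _ _), W1 => /=.
by rewrite res_id linearD /= !(res_comp _ _ (@subset_refl _ _)) !res_id.
Qed.

Lemma germ0 (U : opens X) (Ux : oset U x) : germ Ux 0 = 0.
Proof.
rewrite -[X in germ _ X](addr0 0) -[X in germ _ (X + _)](scaler0 _ (-1)).
by rewrite germP scaleN1r addNr.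
Qed.

End Stalk.
Arguments germ {k X P x U} Ux s.

Section StalkMap.
Variables (k : fieldType) (X : topologicalType) (P Q : presheaf k X).
Variables (f : presheaf_hom P Q) (x : X).

Definition ls_map (s : germ_premodule P x) : germ_premodule Q x :=
  LocalSection (ls_mem s) (f _ (ls_sec s)).

Lemma ls_map_eqv s t : pm_eqv s t -> pm_eqv (ls_map s) (ls_map t).
Proof.
move=> [W [Wx [Ws [Wt e]]]]; exists W, Wx, Ws, Wt => /=.
by rewrite -!hom_res e.
Qed.

Lemma ls_map_linear a s t :
  pm_eqv (ls_map (pm_add (pm_scale a s) t))
         (pm_add (pm_scale a (ls_map s)) (ls_map t)).
Proof.
rewrite /ls_map /=; apply: same_germ_eq.
by rewrite /= linearD /= !hom_res !linearZ.
Qed.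

Definition stalk_map : {linear stalk P x -> stalk Q x} :=
  quotient_map (PremoduleHom ls_map_eqv ls_map_linear).

Lemma stalk_mapE (U : opens X) (Ux : oset U x) (s : P U) :
  stalk_map (germ Ux s) = germ Ux (f U s).
Proof. exact: quotient_mapE. Qed.

End StalkMap.

Section AssociatedSheaf.
Variables (k : fieldType) (X : topologicalType) (P : presheaf k X).

Section Sections.
Variable U : opens X.

Definition locally_section (s : forall x, oset U x -> stalk P x) :=
  forall x, oset U x ->
    exists (W : opens X) (WU : W `<=` U) (t : P W),
      oset W x /\ forall y (Wy : oset W y), s y (WU y Wy) = germ Wy t.

Lemma family_ext (s t : forall x, oset U x -> stalk P x) :
  (forall x Ux, s x Ux = t x Ux) -> s = t.
Proof.
move=> st; apply: functional_extensionality_dep => x.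
exact: functional_extensionality_dep.
Qed.

Definition assoc_sections := {s | locally_section s}.

Lemma assoc_ext (s t : assoc_sections) :
  (forall x Ux, sval s x Ux = sval t x Ux) -> s = t.
Proof.
case: s t => [s ls] [t lt] /= st; apply: eq_exist => /=.
exact: family_ext.
Qed.

Lemma locally_section0 : locally_section (fun _ _ => 0).
Proof.
move=> x Ux; exists U, (@subset_refl _ _), 0; split=> // y Uy.
by rewrite germ0.
Qed.

Lemma locally_sectionP a s t : locally_section s -> locally_section t ->
  locally_section (fun x Ux => a *: s x Ux + t x Ux).
Proof.
move=> ls lt x Ux; have [W [WU [s' [Wx es]]]] := ls x Ux.
have [Z [ZU [t' [Zx et]]]] := lt x Ux.
have IW : opensI W Z `<=` W by move=> ? [].
have IZ : opensI W Z `<=` Z by move=> ? [].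
exists (opensI W Z), (subset_trans IW WU), (a *: res IW s' + res IZ t').
split=> // y Iy; rewrite germP (germ_res (IW _ Iy)) (germ_res (IZ _ Iy)) -es -et.
by congr (_ *: s y _ + t y _); exact: Prop_irrelevance.
Qed.

Lemma locally_sectionN s : locally_section s ->
  locally_section (fun x Ux => - s x Ux).
Proof.
move=> ls; have := locally_sectionP (-1) ls locally_section0.
by congr locally_section; apply: family_ext => x Ux; rewrite scaleN1r addr0.
Qed.

Lemma locally_sectionD s t : locally_section s -> locally_section t ->
  locally_section (fun x Ux => s x Ux + t x Ux).
Proof.
move=> ls lt; have := locally_sectionP 1 ls lt.
by congr locally_section; apply: family_ext => x Ux; rewrite scale1r.
Qed.

Lemma locally_sectionZ a s : locally_section s ->
  locally_section (fun x Ux => a *: s x Ux).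
Proof.
move=> ls; have := locally_sectionP a ls locally_section0.
by congr locally_section; apply: family_ext => x Ux; rewrite addr0.
Qed.

Definition assoc_zero : assoc_sections := exist _ _ locally_section0.
Definition assoc_opp (s : assoc_sections) : assoc_sections :=
  exist _ _ (locally_sectionN (svalP s)).
Definition assoc_add (s t : assoc_sections) : assoc_sections :=
  exist _ _ (locally_sectionD (svalP s) (svalP t)).
Definition assoc_scale a (s : assoc_sections) : assoc_sections :=
  exist _ _ (locally_sectionZ a (svalP s)).

Lemma assoc_addA : associative assoc_add.
Proof. by move=> s t u; apply: assoc_ext => x Ux /=; exact: addrA. Qed.
Lemma assoc_addC : commutative assoc_add.
Proof. by move=> s t; apply: assoc_ext => x Ux /=; exact: addrC. Qed.
Lemma assoc_add0 : left_id assoc_zero assoc_add.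
Proof. by move=> s; apply: assoc_ext => x Ux /=; exact: add0r. Qed.
Lemma assoc_addN : left_inverse assoc_zero assoc_opp assoc_add.
Proof. by move=> s; apply: assoc_ext => x Ux /=; exact: addNr. Qed.

HB.instance Definition _ := gen_eqMixin assoc_sections.
HB.instance Definition _ := gen_choiceMixin assoc_sections.
HB.instance Definition _ := GRing.isZmodule.Build assoc_sections
  assoc_addA assoc_addC assoc_add0 assoc_addN.

Lemma assoc_scaleA a b s : assoc_scale a (assoc_scale b s) = assoc_scale (a * b) s.
Proof. by apply: assoc_ext => x Ux /=; exact: scalerA. Qed.
Lemma assoc_scale1 : left_id 1 assoc_scale.
Proof. by move=> s; apply: assoc_ext => x Ux /=; exact: scale1r. Qed.
Lemma assoc_scaleDr : right_distributive assoc_scale +%R.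
Proof. by move=> a s t; apply: assoc_ext => x Ux /=; exact: scalerDr. Qed.
Lemma assoc_scaleDl s : {morph assoc_scale^~ s : a b / a + b}.
Proof. by move=> a b; apply: assoc_ext => x Ux /=; exact: scalerDl. Qed.

HB.instance Definition _ := GRing.Zmodule_isLmodule.Build k assoc_sections
  assoc_scaleA assoc_scale1 assoc_scaleDr assoc_scaleDl.

End Sections.

Section Restriction.
Variables (U W : opens X) (WU : W `<=` U).

Lemma locally_section_res (s : forall x, oset U x -> stalk P x) :
  locally_section s -> locally_section (fun x (Wx : oset W x) => s x (WU Wx)).
Proof.
move=> ls x Wx; have [Z [ZU [t [Zx et]]]] := ls x (WU Wx).
have IW : opensI W Z `<=` W by move=> ? [].
have IZ : opensI W Z `<=` Z by move=> ? [].
exists (opensI W Z), IW, (res IZ t); split=> // y Iy.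
rewrite (germ_res (IZ _ Iy)) -et.
by congr (s y _); exact: Prop_irrelevance.
Qed.

Definition assoc_res (s : assoc_sections U) : assoc_sections W :=
  exist _ _ (locally_section_res (svalP s)).

Lemma assoc_res_linear : linear assoc_res.
Proof. by move=> a s t; exact: assoc_ext. Qed.

HB.instance Definition _ := GRing.isLinear.Build k (assoc_sections U)
  (assoc_sections W) *:%R assoc_res assoc_res_linear.

End Restriction.

Lemma assoc_res_id (U : opens X) (UU : U `<=` U) (s : assoc_sections U) :
  assoc_res UU s = s.
Proof.
apply: assoc_ext => x Ux /=.
by congr (sval s x _); exact: Prop_irrelevance.
Qed.

Lemma assoc_res_comp (U W Z : opens X) (WU : W `<=` U) (ZW : Z `<=` W)
    (ZU : Z `<=` U) (s : assoc_sections U) :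
  assoc_res ZW (assoc_res WU s) = assoc_res ZU s.
Proof.
apply: assoc_ext => x Zx /=.
by congr (sval s x _); exact: Prop_irrelevance.
Qed.

(* U |-> families of germs at the points of U which are locally given by
   sections of P *)
Definition associated_presheaf : presheaf k X :=
  @Presheaf k X (fun U => assoc_sections U) (fun U W WU => assoc_res WU)
    assoc_res_id assoc_res_comp.

Lemma associated_is_sheaf : is_sheaf associated_presheaf.
Proof.
move=> I U W UW WU; split=> [s t st|s sE].
  apply: assoc_ext => x Wx; have [i _ Uix] := WU x Wx.
  have /(congr1 (fun u => sval u x Uix)) /= := st i.
  by rewrite (Prop_irrelevance (UW i x Uix) Wx).
have ix x (Wx : oset W x) : {i | oset (U i) x}.
  by apply: cid; have [i _ Uix] := WU x Wx; exists i.
have sij i j x (Ui : oset (U i) x) (Uj : oset (U j) x) :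
    sval (s i) x Ui = sval (s j) x Uj.
  have /(congr1 (fun u => sval u x (conj Ui Uj))) /= := sE i j.
  by rewrite (Prop_irrelevance (subIsetl _) Ui) (Prop_irrelevance (subIsetr _) Uj).
have lt : @locally_section W
    (fun x Wx => sval (s (projT1 (ix x Wx))) x (projT2 (ix x Wx))).
  move=> x Wx; case: (ix x Wx) => i Uix.
  have [Z [ZU [t [Zx et]]]] := svalP (s i) x Uix.
  exists Z, (subset_trans ZU (UW i)), t; split=> // y Zy.
  by rewrite -et; exact: sij.
by exists (exist _ _ lt) => i; apply: assoc_ext => x Uix /=; exact: sij.
Qed.

Definition associated_sheaf : sheaf k X := Sheaf associated_is_sheaf.

End AssociatedSheaf.

Section AssociatedSheafMap.
Variables (k : fieldType) (X : topologicalType) (P Q : presheaf k X).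
Variable f : presheaf_hom P Q.

Lemma locally_section_map (U : opens X) (s : forall x, oset U x -> stalk P x) :
  locally_section s -> locally_section (fun x Ux => stalk_map f x (s x Ux)).
Proof.
move=> ls x Ux; have [W [WU [t [Wx et]]]] := ls x Ux.
by exists W, WU, (f W t); split=> // y Wy; rewrite et stalk_mapE.
Qed.

Definition assoc_map (U : opens X) (s : assoc_sections P U) : assoc_sections Q U :=
  exist _ _ (locally_section_map (svalP s)).

Lemma assoc_map_linear U : linear (@assoc_map U).
Proof. by move=> a s t; apply: assoc_ext => x Ux /=; exact: linearP. Qed.

HB.instance Definition _ U := GRing.isLinear.Build k (assoc_sections P U)
  (assoc_sections Q U) *:%R (@assoc_map U) (@assoc_map_linear U).

Lemma assoc_map_res (U W : opens X) (WU : W `<=` U) (s : assoc_sections P U) :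
  @assoc_map W (assoc_res WU s) = assoc_res WU (assoc_map s).
Proof. exact: assoc_ext. Qed.

Definition associated_hom :
    presheaf_hom (associated_sheaf P) (associated_sheaf Q) :=
  @PresheafHom k X (associated_sheaf P) (associated_sheaf Q)
    (fun U => @assoc_map U) assoc_map_res.

End AssociatedSheafMap.

Section Cohomology.
Variables (k : fieldType) (A B C : lmodType k).
Variables (d0 : {linear A -> B}) (d1 : {linear B -> C}).

Definition cocycle := {b : B | d1 b = 0}.
Definition cohomologous (b b' : cocycle) := exists a, sval b - sval b' = d0 a.

Lemma cocycleP c b b' : d1 b = 0 -> d1 b' = 0 -> d1 (c *: b + b') = 0.
Proof. by move=> e e'; rewrite linearP e e' scaler0 addr0. Qed.
Lemma cocycleD b b' : d1 b = 0 -> d1 b' = 0 -> d1 (b + b') = 0.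
Proof. by move=> e e'; rewrite linearD e e' addr0. Qed.
Lemma cocycleZ c b : d1 b = 0 -> d1 (c *: b) = 0.
Proof. by move=> e; rewrite linearZ /= e scaler0. Qed.

Definition cocycle_zero : cocycle := exist _ 0 (linear0 d1).
Definition cocycle_add (b b' : cocycle) : cocycle :=
  exist _ _ (cocycleD (svalP b) (svalP b')).
Definition cocycle_scale c (b : cocycle) : cocycle :=
  exist _ _ (cocycleZ c (svalP b)).

Lemma cohomologous_refl b : cohomologous b b.
Proof. by exists 0; rewrite linear0 subrr. Qed.
Lemma cohomologous_sym b b' : cohomologous b b' -> cohomologous b' b.
Proof. by move=> [a e]; exists (- a); rewrite -opprB e linearN. Qed.
Lemma cohomologous_trans b b' b'' :
  cohomologous b b' -> cohomologous b' b'' -> cohomologous b b''.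
Proof.
move=> [a e] [a' e']; exists (a + a').
by rewrite linearD /= -e -e' addrA subrK.
Qed.
Lemma cohomologousD b b' c c' : cohomologous b b' -> cohomologous c c' ->
  cohomologous (cocycle_add b c) (cocycle_add b' c').
Proof.
by move=> [a e] [a' e']; exists (a + a'); rewrite linearD /= -e -e' opprD addrACA.
Qed.
Lemma cohomologousZ c b b' : cohomologous b b' ->
  cohomologous (cocycle_scale c b) (cocycle_scale c b').
Proof. by move=> [a e]; exists (c *: a); rewrite /= -scalerBr e linearZ. Qed.
Lemma cohomologous_eq b b' : sval b = sval b' -> cohomologous b b'.
Proof. by move=> e; exists 0; rewrite linear0 e subrr. Qed.

Definition cohomology_premodule : premodule k.
Proof.
refine (@Premodule k cocycle cohomologous cocycle_zero cocycle_add cocycle_scale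
  cohomologous_refl cohomologous_sym cohomologous_trans cohomologousD
  cohomologousZ _ _ _ _ _ _ _ _).
- by move=> x y z; apply: cohomologous_eq; exact: addrA.
- by move=> x y; apply: cohomologous_eq; exact: addrC.
- by move=> x; apply: cohomologous_eq; exact: add0r.
- by move=> x; apply: cohomologous_eq; rewrite /= scaleN1r addNr.
- by move=> a b x; apply: cohomologous_eq; exact: scalerA.
- by move=> x; apply: cohomologous_eq; exact: scale1r.
- by move=> a x y; apply: cohomologous_eq; exact: scalerDr.
- by move=> x a b; apply: cohomologous_eq; exact: scalerDl.
Defined.

(* Ker d1 / Im d0; only used when d1 d0 = 0 *)
Definition cohomology : lmodType k := quotient_module cohomology_premodule.

Definition cohomology_class (b : B) (db : d1 b = 0) : cohomology :=
  @class_of k cohomology_premodule (exist _ b db).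

Lemma cohomology_class_eq b (db : d1 b = 0) b' (db' : d1 b' = 0) :
  cohomology_class db = cohomology_class db' <-> exists a, b - b' = d0 a.
Proof. exact: class_of_eq. Qed.

Lemma cohomology_class_surj (h : cohomology) :
  exists b (db : d1 b = 0), h = cohomology_class db.
Proof. by have [[b db] ->] := class_of_surj h; exists b, db. Qed.

End Cohomology.
Arguments cohomology_class {k A B C} d0 {d1 b} db.

Section CohomologyMap.
Variables (k : fieldType) (A B C A' B' C' : lmodType k).
Variables (d0 : {linear A -> B}) (d1 : {linear B -> C}).
Variables (d0' : {linear A' -> B'}) (d1' : {linear B' -> C'}).
Variables (f : {linear A -> A'}) (g : {linear B -> B'}) (h : {linear C -> C'}).
Hypothesis gd0 : forall a, g (d0 a) = d0' (f a).
Hypothesis hd1 : forall b, h (d1 b) = d1' (g b).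

Lemma cocycle_map_proof b : d1 b = 0 -> d1' (g b) = 0.
Proof. by rewrite -hd1 => ->; rewrite linear0. Qed.

Definition cocycle_map (b : cohomology_premodule d0 d1) :
    cohomology_premodule d0' d1' :=
  exist _ _ (cocycle_map_proof (svalP b)).

Lemma cocycle_map_eqv b b' :
  pm_eqv b b' -> pm_eqv (cocycle_map b) (cocycle_map b').
Proof. by move=> [a e]; exists (f a); rewrite -gd0 -e /= linearB. Qed.

Lemma cocycle_map_linear a b b' :
  pm_eqv (cocycle_map (pm_add (pm_scale a b) b'))
         (pm_add (pm_scale a (cocycle_map b)) (cocycle_map b')).
Proof. by apply: cohomologous_eq => /=; exact: linearP. Qed.

Definition cohomology_map :
    {linear cohomology d0 d1 -> cohomology d0' d1'} :=
  quotient_map (PremoduleHom cocycle_map_eqv cocycle_map_linear).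

Lemma cohomology_mapE b (db : d1 b = 0) :
  cohomology_map (cohomology_class d0 db) =
  cohomology_class d0' (cocycle_map_proof db).
Proof.
rewrite [LHS](quotient_mapE (PremoduleHom cocycle_map_eqv cocycle_map_linear)).
by apply/class_of_eq; exact: cohomologous_eq.
Qed.

End CohomologyMap.

Section CohomologyPresheaf.
Variables (k : fieldType) (X : topologicalType) (P Q S : presheaf k X).
Variables (d0 : presheaf_hom P Q) (d1 : presheaf_hom Q S).

Definition cohomology_res (U W : opens X) (WU : W `<=` U) :
    {linear cohomology (d0 U) (d1 U) -> cohomology (d0 W) (d1 W)} :=
  cohomology_map (fun a => esym (hom_res d0 WU a))
    (fun b => esym (hom_res d1 WU b)).

Lemma cohomology_resE (U W : opens X) (WU : W `<=` U) (b : Q U)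
    (db : d1 U b = 0) :
  exists db' : d1 W (res WU b) = 0,
    cohomology_res WU (cohomology_class (d0 U) db) =
    cohomology_class (d0 W) db'.
Proof. by eexists; exact: cohomology_mapE. Qed.

Lemma cohomology_res_id (U : opens X) (UU : U `<=` U) s :
  cohomology_res UU s = s.
Proof.
have [b [db ->]] := cohomology_class_surj s.
have [db' ->] := cohomology_resE UU db; apply/cohomology_class_eq; exists 0; rewrite linear0; apply/eqP.
by rewrite subr_eq0 res_id.
Qed.

Lemma cohomology_res_comp (U W Z : opens X) (WU : W `<=` U) (ZW : Z `<=` W)
    (ZU : Z `<=` U) s :
  cohomology_res ZW (cohomology_res WU s) = cohomology_res ZU s.
Proof.
have [b [db ->]] := cohomology_class_surj s.
have [dbW ->] := cohomology_resE WU db; have [dbZ ->] := cohomology_resE ZW dbW.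
have [dbZ' ->] := cohomology_resE ZU db; apply/cohomology_class_eq; exists 0.
by rewrite linear0; apply/eqP; rewrite subr_eq0 (res_comp WU ZW ZU).
Qed.

Definition cohomology_presheaf : presheaf k X :=
  Presheaf cohomology_res_id cohomology_res_comp.

End CohomologyPresheaf.

Section CohomologyPresheafMap.
Variables (k : fieldType) (X : topologicalType) (P Q S P' Q' S' : presheaf k X).
Variables (d0 : presheaf_hom P Q) (d1 : presheaf_hom Q S).
Variables (d0' : presheaf_hom P' Q') (d1' : presheaf_hom Q' S').
Variables (f : presheaf_hom P P') (g : presheaf_hom Q Q') (h : presheaf_hom S S').
Hypothesis gd0 : forall U a, g U (d0 U a) = d0' U (f U a).
Hypothesis hd1 : forall U b, h U (d1 U b) = d1' U (g U b).

Lemma cohomology_map_res (U W : opens X) (WU : W `<=` U)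
    (s : cohomology_presheaf d0 d1 U) :
  cohomology_map (@gd0 W) (@hd1 W) (res WU s) =
  res (p := cohomology_presheaf d0' d1') WU
    (cohomology_map (@gd0 U) (@hd1 U) s).
Proof.
have [b [db ->]] := cohomology_class_surj s.
have [dbW e] := cohomology_resE d0 WU db.
have [dbW' e'] := cohomology_resE d0' WU (cocycle_map_proof (@hd1 U) db).
rewrite cohomology_mapE [in RHS]/res [RHS]e' [X in cohomology_map _ _ X = _]e.
rewrite cohomology_mapE; apply/cohomology_class_eq; exists 0; rewrite linear0.
by apply/eqP; rewrite subr_eq0 hom_res.
Qed.

Definition cohomology_presheaf_hom :
    presheaf_hom (cohomology_presheaf d0 d1) (cohomology_presheaf d0' d1') :=
  @PresheafHom k X (cohomology_presheaf d0 d1) (cohomology_presheaf d0' d1')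
    (fun U => cohomology_map (@gd0 U) (@hd1 U)) cohomology_map_res.

End CohomologyPresheafMap.

Record complex (k : fieldType) (X : topologicalType) := Complex {
  cobj :> int -> sheaf k X;
  cdiff : forall n, presheaf_hom (cobj n) (cobj (n + 1));
  cdiffK : forall n (U : opens X) (s : cobj n U),
    cdiff (n + 1) U (cdiff n U s) = 0 }.

Record complex_hom (k : fieldType) (X : topologicalType)
    (F G : complex k X) := ComplexHom {
  cmap :> forall n, presheaf_hom (F n) (G n);
  cmap_diff : forall n (U : opens X) (s : F n U),
    cmap (n + 1) U (cdiff F n U s) = cdiff G n U (cmap n U s) }.

Section QuasiIsomorphism.
Variables (k : fieldType) (X : topologicalType).

(* H^(n + 1)(F); indexing by the successor avoids transporting along
   n - 1 + 1 = n *)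
Definition cohomology_sheaf (F : complex k X) (n : int) : sheaf k X :=
  associated_sheaf (cohomology_presheaf (cdiff F n) (cdiff F (n + 1))).

Definition cohomology_sheaf_hom (F G : complex k X) (f : complex_hom F G) n :
    presheaf_hom (cohomology_sheaf F n) (cohomology_sheaf G n) :=
  associated_hom
    (cohomology_presheaf_hom (@cmap_diff _ _ _ _ f n) (@cmap_diff _ _ _ _ f (n + 1))).

Definition quasi_isomorphism (F G : complex k X) (f : complex_hom F G) :=
  forall n, is_isomorphism (cohomology_sheaf_hom f n).

End QuasiIsomorphism.

Section StalkwiseIsomorphism.
Variables (k : fieldType) (X : topologicalType) (P Q : presheaf k X).
Variable f : presheaf_hom P Q.

Definition locally_injective := forall (U : opens X) (s : P U), f U s = 0 ->
  forall x, oset U x -> exists (W : opens X) (WU : W `<=` U),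
    oset W x /\ res WU s = 0.

Definition locally_surjective := forall (U : opens X) (t : Q U) x, oset U x ->
  exists (W : opens X) (WU : W `<=` U) (s : P W),
    oset W x /\ f W s = res WU t.

Lemma locally_section_germ (R : presheaf k X) (U : opens X) (s : R U) :
  locally_section (fun x (Ux : oset U x) => germ Ux s).
Proof.
move=> x Ux; exists U, (@subset_refl _ _), s; split=> // y Uy.
by congr germ; exact: Prop_irrelevance.
Qed.

Definition associated_unit (R : presheaf k X) (U : opens X) (s : R U) :
  associated_sheaf R U := exist _ _ (locally_section_germ s).

Lemma stalk_map_inj x : locally_injective -> injective (stalk_map f x).
Proof.
move=> linj; apply: raddf_inj => q.
have [U [Ux [s ->]]] := germ_surj q => fs0.
have : germ Ux (f U s) = germ Ux 0.
  by rewrite germ0 -stalk_mapE; exact: fs0.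
move=> /germ_eq [W [Wx [WU [WU' e]]]].
have /linj : f W (res WU s) = 0 by rewrite hom_res e linear0.
move=> /(_ x Wx) [Z [ZW [Zx e']]].
by rewrite -(germ_res Ux Wx WU) -(germ_res Wx Zx ZW) e' germ0.
Qed.

Lemma stalk_map_surj x (q : stalk Q x) :
  locally_surjective -> exists p, stalk_map f x p = q.
Proof.
move=> lsurj; have [U [Ux [t ->]]] := germ_surj q.
have [W [WU [s [Wx e]]]] := lsurj U t x Ux.
by exists (germ Wx s); rewrite stalk_mapE e germ_res.
Qed.

Lemma associated_hom_isoP :
  is_isomorphism (associated_hom f) <-> locally_injective /\ locally_surjective.
Proof.
split=> [[g [gK fK]]|[linj lsurj]].
  split=> [U s fs0 x Ux|U t x Ux].
    have es0 : associated_unit s = 0.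
      rewrite -[associated_unit s]gK -[RHS](linear0 (g U)); congr (g U _).
      by apply: assoc_ext => y Uy /=; rewrite stalk_mapE fs0 germ0.
    have : germ Ux s = germ Ux 0.
      by rewrite germ0 -[LHS]/(sval (associated_unit s) x Ux) es0.
    move=> /germ_eq [W [Wx [WU [WU' e]]]].
    by exists W, WU; split=> //; rewrite e linear0.
  have /= := congr1 (fun u => sval u x Ux) (fK U (associated_unit t)).
  have [W [Wx [s ->]]] := germ_surj (sval (g U (associated_unit t)) x Ux).
  rewrite stalk_mapE => /germ_eq [Z [Zx [ZW [ZU e]]]].
  by exists Z, ZU, (res ZW s); split=> //; rewrite hom_res.
pose inv x (q : stalk Q x) := projT1 (cid (stalk_map_surj q lsurj)).
have invK x q : stalk_map f x (inv x q) = q by rewrite /inv; case: cid.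
have Kinv x p : inv x (stalk_map f x p) = p.
  by apply: (stalk_map_inj linj); rewrite invK.
have linv (U : opens X) (t : forall x, oset U x -> stalk Q x) :
    locally_section t -> locally_section (fun x Ux => inv x (t x Ux)).
  move=> lt x Ux; have [W [WU [t' [Wx et]]]] := lt x Ux.
  have [Z [ZW [s [Zx e]]]] := lsurj W t' x Wx.
  exists Z, (subset_trans ZW WU), s; split=> // y Zy.
  rewrite -[RHS]Kinv stalk_mapE e (germ_res (ZW _ Zy)) -et.
  by congr (inv y (t y _)); exact: Prop_irrelevance.
pose g (U : opens X) (t : assoc_sections Q U) : assoc_sections P U :=
  exist _ _ (linv U _ (svalP t)).
have glin U : linear (g U).
  move=> a s t; apply: assoc_ext => x Ux /=.
  apply: (stalk_map_inj linj); rewrite invK [RHS]linearP.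
  by rewrite !invK.
pose gL U : {linear assoc_sections Q U -> assoc_sections P U} :=
  HB.pack (g U) (GRing.isLinear.Build k _ _ *:%R (g U) (glin U)).
have gres (U W : opens X) (WU : W `<=` U) (s : assoc_sections Q U) :
    gL W (assoc_res WU s) = assoc_res WU (gL U s).
  exact: assoc_ext.
exists (@PresheafHom k X (associated_sheaf Q) (associated_sheaf P) gL gres).
by split=> U s; apply: assoc_ext => x Ux; [exact: Kinv | exact: invK].
Qed.

End StalkwiseIsomorphism.

Lemma quasi_isomorphismP (k : fieldType) (X : topologicalType)
    (F G : complex k X) (f : complex_hom F G) :
  quasi_isomorphism f <-> forall n,
    (forall (U : opens X) (s : F (n + 1) U) (t : G n U),
       cdiff F (n + 1) U s = 0 -> f (n + 1) U s = cdiff G n U t ->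
       forall x, oset U x -> exists (W : opens X) (WU : W `<=` U) (u : F n W),
         oset W x /\ res WU s = cdiff F n W u) /\
    (forall (U : opens X) (t : G (n + 1) U), cdiff G (n + 1) U t = 0 ->
       forall x, oset U x -> exists (W : opens X) (WU : W `<=` U)
         (s : F (n + 1) W) (u : G n W),
         [/\ oset W x, cdiff F (n + 1) W s = 0 &
             f (n + 1) W s - res WU t = cdiff G n W u]).
Proof.
split=> qf n; last first.
  have [finj fsurj] := qf n; apply/associated_hom_isoP; split.
    move=> U h; have [b [db ->]] := cohomology_class_surj h => fb0 x Ux.
    have [t e] : exists t, f (n + 1) U b - 0 = cdiff G n U t.
      have d0 : cdiff G (n + 1) U 0 = 0 by rewrite linear0.
      apply/(cohomology_class_eq (cdiff G n U)
        (cocycle_map_proof (@cmap_diff _ _ _ _ f (n + 1) U) db) d0).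
      move: fb0; rewrite [LHS]cohomology_mapE => ->.
      by apply/esym/class_of_eq/cohomologous_eq.
    have [W [WU [u [Wx e']]]] := finj U b t db (etrans (esym (subr0 _)) e) x Ux.
    exists W, WU; split=> //; have [dbW ->] := cohomology_resE (cdiff F n) WU db.
    by apply/class_of_eq; exists u; rewrite /= subr0.
  move=> U h x Ux; have [t [dt ->]] := cohomology_class_surj h.
  have [W [WU [s [u [Wx ds e]]]]] := fsurj U t dt x Ux.
  exists W, WU, (cohomology_class _ ds); split=> //.
  have [dtW ->] := cohomology_resE (cdiff G n) WU dt.
  by rewrite [LHS]cohomology_mapE; apply/class_of_eq; exists u.
have [finj fsurj] := (associated_hom_isoP _).1 (qf n); split.
  move=> U s t ds e x Ux.
  have /finj : cohomology_presheaf_hom (@cmap_diff _ _ _ _ f n)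
      (@cmap_diff _ _ _ _ f (n + 1)) U (cohomology_class _ ds) = 0.
    by rewrite [LHS]cohomology_mapE; apply/class_of_eq; exists t; rewrite /= subr0.
  move=> /(_ x Ux) [W [WU [Wx]]].
  have [dsW ->] := cohomology_resE (cdiff F n) WU ds.
  by move=> /class_of_eq [u /=]; rewrite subr0 => e'; exists W, WU, u.
move=> U t dt x Ux.
have [W [WU [h [Wx]]]] := fsurj U (cohomology_class _ dt) x Ux.
have [s [ds ->]] := cohomology_class_surj h.
have [dtW ->] := cohomology_resE (cdiff G n) WU dt.
rewrite [LHS]cohomology_mapE => /class_of_eq [u /= e].
by exists W, WU, s, u.
Qed.

Section ComplexCategory.
Variables (k : fieldType) (X : topologicalType).

Definition presheaf_id (P : presheaf k X) : presheaf_hom P P :=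
  @PresheafHom k X P P (fun U => idfun) (fun _ _ _ _ => erefl).

Lemma presheaf_comp_res (P Q S : presheaf k X) (g : presheaf_hom Q S)
    (f : presheaf_hom P Q) (U W : opens X) (WU : W `<=` U) (s : P U) :
  g W (f W (res WU s)) = res WU (g U (f U s)).
Proof. by rewrite !hom_res. Qed.

Definition presheaf_comp (P Q S : presheaf k X) (g : presheaf_hom Q S)
    (f : presheaf_hom P Q) : presheaf_hom P S :=
  @PresheafHom k X P S (fun U => g U \o f U) (presheaf_comp_res g f).

Definition complex_id (F : complex k X) : complex_hom F F :=
  @ComplexHom k X F F (fun n => presheaf_id (F n)) (fun _ _ _ => erefl).

Lemma complex_comp_diff (F G H : complex k X) (g : complex_hom G H)
    (f : complex_hom F G) n (U : opens X) (s : F n U) :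
  g (n + 1) U (f (n + 1) U (cdiff F n U s)) = cdiff H n U (g n U (f n U s)).
Proof. by rewrite !cmap_diff. Qed.

Definition complex_comp (F G H : complex k X) (g : complex_hom G H)
    (f : complex_hom F G) : complex_hom F H :=
  @ComplexHom k X F H (fun n => presheaf_comp (g n) (f n))
    (complex_comp_diff g f).

(* The objects of D(k_X) are the unbounded complexes of sheaves of k-modules.
   D(k_X) is the localization of their category at the quasi-isomorphisms:
   its morphisms are the formal composites of morphisms of complexes and of
   inverses of quasi-isomorphisms, modulo [derived_eq]. *)
Inductive derived_hom : complex k X -> complex k X -> Type :=
| dh_map F G : complex_hom F G -> derived_hom F G
| dh_inv F G (w : complex_hom F G) : quasi_isomorphism w -> derived_hom G F
| dh_comp F G H : derived_hom G H -> derived_hom F G -> derived_hom F H.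

Inductive derived_eq : forall F G, derived_hom F G -> derived_hom F G -> Prop :=
| de_refl F G (f : derived_hom F G) : derived_eq f f
| de_sym F G (f g : derived_hom F G) : derived_eq f g -> derived_eq g f
| de_trans F G (f g h : derived_hom F G) :
    derived_eq f g -> derived_eq g h -> derived_eq f h
| de_comp F G H (g g' : derived_hom G H) (f f' : derived_hom F G) :
    derived_eq g g' -> derived_eq f f' ->
    derived_eq (dh_comp g f) (dh_comp g' f')
| de_assoc F G H K (h : derived_hom H K) (g : derived_hom G H)
    (f : derived_hom F G) :
    derived_eq (dh_comp h (dh_comp g f)) (dh_comp (dh_comp h g) f)
| de_idl F G (f : derived_hom F G) :
    derived_eq (dh_comp (dh_map (complex_id G)) f) f
| de_idr F G (f : derived_hom F G) :
    derived_eq (dh_comp f (dh_map (complex_id F))) f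
| de_map F G H (g : complex_hom G H) (f : complex_hom F G) :
    derived_eq (dh_comp (dh_map g) (dh_map f)) (dh_map (complex_comp g f))
| de_invl F G (w : complex_hom F G) (qw : quasi_isomorphism w) :
    derived_eq (dh_comp (dh_inv qw) (dh_map w)) (dh_map (complex_id F))
| de_invr F G (w : complex_hom F G) (qw : quasi_isomorphism w) :
    derived_eq (dh_comp (dh_map w) (dh_inv qw)) (dh_map (complex_id G)).

End ComplexCategory.

Section DirectImage.
Variables (k : fieldType) (X Y : topologicalType) (f : X -> Y).
Hypothesis cf : continuous f.

Definition preimageS (U W : opens Y) (WU : W `<=` U) :
  preimage_opens cf W `<=` preimage_opens cf U := fun x => WU (f x).

Definition direct_image_presheaf (P : presheaf k X) : presheaf k Y :=
  @Presheaf k Y (fun U => P (preimage_opens cf U))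
    (fun U W WU => res (preimageS WU))
    (fun U UU s => res_id (preimageS UU) s)
    (fun U W Z WU ZW ZU s =>
       res_comp (preimageS WU) (preimageS ZW) (preimageS ZU) s).

Lemma direct_image_is_sheaf (F : sheaf k X) :
  is_sheaf (direct_image_presheaf F).
Proof.
move=> I U W UW WU.
have WU' : preimage_opens cf W `<=` \bigcup_i preimage_opens cf (U i).
  by move=> x /WU [i _ Uix]; exists i.
have [sep glue] := @sheafP k X F I _ _ (fun i => preimageS (UW i)) WU'; split=> //.
move=> s sE; apply: glue => i j.
pose T := opensI (preimage_opens cf (U i)) (preimage_opens cf (U j)).
have TI : T `<=` preimage_opens cf (opensI (U i) (U j)) by [].
have := congr1 (res TI) (sE i j).
rewrite (res_comp _ TI (@subIsetl _ _ _)) (res_comp _ TI (@subIsetr _ _ _)).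
exact.
Qed.

Definition direct_image (F : sheaf k X) : sheaf k Y :=
  Sheaf (direct_image_is_sheaf F).

Definition direct_image_hom (P Q : presheaf k X) (u : presheaf_hom P Q) :
    presheaf_hom (direct_image_presheaf P) (direct_image_presheaf Q) :=
  @PresheafHom k Y (direct_image_presheaf P) (direct_image_presheaf Q)
    (fun U => u (preimage_opens cf U))
    (fun U W WU s => hom_res u (preimageS WU) s).

Definition direct_image_complex (F : complex k X) : complex k Y :=
  @Complex k Y (fun n => direct_image (F n))
    (fun n => direct_image_hom (cdiff F n))
    (fun n U s => @cdiffK _ _ F n _ s).

Definition direct_image_complex_hom (F G : complex k X) (u : complex_hom F G) :
    complex_hom (direct_image_complex F) (direct_image_complex G) :=
  @ComplexHom k Y (direct_image_complex F) (direct_image_complex G)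
    (fun n => direct_image_hom (u n))
    (fun n U s => @cmap_diff _ _ _ _ u n _ s).

Hypothesis direct_image_qis : forall (F G : complex k X) (w : complex_hom F G),
  quasi_isomorphism w -> quasi_isomorphism (direct_image_complex_hom w).

Fixpoint direct_image_derived (F G : complex k X) (u : derived_hom F G) :
    derived_hom (direct_image_complex F) (direct_image_complex G) :=
  match u with
  | dh_map _ _ v => dh_map (direct_image_complex_hom v)
  | dh_inv _ _ _ qw => dh_inv (direct_image_qis qw)
  | dh_comp _ _ _ v w =>
      dh_comp (direct_image_derived v) (direct_image_derived w)
  end.

End DirectImage.
Arguments preimageS {X Y f} cf {U W} WU.

Lemma direct_image_qis_homeo (k : fieldType) (X Y : topologicalType)
    (f : X -> Y) (g : Y -> X) (cf : continuous f) :
  continuous g -> cancel f g -> cancel g f ->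
  forall (F G : complex k X) (w : complex_hom F G),
  quasi_isomorphism w -> quasi_isomorphism (direct_image_complex_hom cf w).
Proof.
move=> cg fK gK F G w /quasi_isomorphismP qw; apply/quasi_isomorphismP => n.
have [winj wsurj] := qw n; split.
  move=> U s t ds e y Uy.
  have Ugy : oset (preimage_opens cf U) (g y) by rewrite /= gK.
  have [W [WU [u [Wy e']]]] := winj (preimage_opens cf U) s t ds e _ Ugy.
  have WW : preimage_opens cf (preimage_opens cg W) `<=` W.
    by move=> x /=; rewrite fK.
  have WU' : preimage_opens cg W `<=` U by move=> z /= /WU /=; rewrite gK.
  exists (preimage_opens cg W), WU', (res WW u); split=> //=.
  rewrite -[LHS](res_comp WU WW) e'; exact/esym/hom_res.
move=> U t dt y Uy.
have Ugy : oset (preimage_opens cf U) (g y) by rewrite /= gK.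
have [W [WU [s [u [Wy ds e]]]]] := wsurj (preimage_opens cf U) t dt _ Ugy.
have WW : preimage_opens cf (preimage_opens cg W) `<=` W.
  by move=> x /=; rewrite fK.
have WU' : preimage_opens cg W `<=` U by move=> z /= /WU /=; rewrite gK.
exists (preimage_opens cg W), WU', (res WW s), (res WW u); split=> //=.
  by rewrite [LHS]hom_res ds linear0.
rewrite [RHS]hom_res -e linearB /= -hom_res; congr (_ - _).
by rewrite -[LHS](res_comp WU WW).
Qed.

(* V is a normed space in what follows only in order to carry its usual topology:
   all norms on a finite dimensional real vector space are equivalent. *)
Definition finite_dimensional (R : realType) (V : normedModType R) :=
  exists (n : nat) (f : {linear V -> 'rV[R]_n}), bijective f.

Definition antipode (R : realType) (V : normedModType R) (A : set V) : set V :=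
  [set - x | x in A].

Record cone (R : realType) (V : normedModType R) := Cone {
  cset :> set V;
  cone_closed : closed cset;
  cone_convex : @convex_set R V cset;
  cone_scale : forall (a : R) x, 0 < a -> cset x -> cset (a *: x);
  cone_interior : cset° !=set0;
  cone_proper : cset `&` antipode cset = [set 0] }.

Inductive cone_topology := Alexandrov | Gamma.

Section ConeSpace.
Variables (R : realType) (V : normedModType R).

Lemma cone0 (C : cone V) : cset C 0.
Proof. by have [] : (cset C `&` antipode C) 0 by rewrite cone_proper. Qed.

Definition cone_open (t : cone_topology) (C : cone V) (U : set V) :=
  match t with Alexandrov => True | Gamma => open U end /\
  [set x + c | x in U & c in cset C] = U.

(* [cone_space Alexandrov C] and [cone_space Gamma C] are V with the Alexandrov
   topology and with the gamma-topology *)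
Definition cone_space (t : cone_topology) (C : cone V) : Type := V.

Variables (t : cone_topology) (C : cone V).

Lemma cone_openP (U : set V) :
  cone_open t C U <-> match t with Alexandrov => True | Gamma => open U end /\
    forall x c, U x -> cset C c -> U (x + c).
Proof.
split=> [[oU UC]|[oU UC]]; split=> //.
  by move=> x c Ux Cc; rewrite -UC; exists x => //; exists c.
apply/seteqP; split=> [_ [x Ux [c Cc <-]]|x Ux]; first exact: UC.
by exists x => //; exists 0; [exact: cone0 | rewrite addr0].
Qed.

Lemma cone_openT : cone_open t C setT.
Proof. by apply/cone_openP; split=> //; case: t => //; exact: openT. Qed.

Lemma cone_openI : setI_closed (cone_open t C).
Proof.
move=> U W /cone_openP [oU UC] /cone_openP [oW WC]; apply/cone_openP; split.
  by case: t oU oW => //; exact: openI.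
by move=> x c [Ux Wx] Cc; split; [exact: UC | exact: WC].
Qed.

Lemma cone_open_bigU (I : Type) (U : I -> set V) :
  (forall i, cone_open t C (U i)) -> cone_open t C (\bigcup_i U i).
Proof.
move=> oU; apply/cone_openP; split.
  case: t oU => // oU; apply: bigcup_open => i _; exact: (oU i).1.
move=> x c [i _ Uix] Cc; exists i => //.
by have /cone_openP [_] := oU i; apply.
Qed.

HB.instance Definition _ := Choice.copy (cone_space t C) V.
HB.instance Definition _ := isOpenTopological.Build (cone_space t C)
  cone_openT cone_openI cone_open_bigU.

Lemma open_coneE (U : set (cone_space t C)) : open U = cone_open t C U.
Proof. by []. Qed.

Definition tau (v : V) (x : cone_space t C) : cone_space t C := (x : V) - v.

Lemma tau_continuous v : continuous (tau v).
Proof.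
apply/continuousP => U oU'; have /cone_openP [oU UC] : cone_open t C U := oU'.
rewrite open_coneE; apply/cone_openP; split.
  case: t U {oU'} oU UC => // U oU _.
  apply: (@open_comp V V (fun x : V => x - v) U _ oU) => x _.
  by apply: (@continuousB _ _ _ id (cst v)); [exact: cvg_id | exact: cvg_cst].
by move=> x c /= Ux Cc; rewrite /tau addrAC; exact: UC.
Qed.

Lemma tauK v : cancel (tau v) (tau (- v)).
Proof. by move=> x; rewrite /tau opprK subrK. Qed.

Lemma tauNK v : cancel (tau (- v)) (tau v).
Proof. by move=> x; rewrite /tau opprK addrK. Qed.

Variable k : fieldType.
Local Notation D := (complex k (cone_space t C)).

(* (tau_v* F)(U) = F(U + v), since the preimage of U under tau_v is U + v *)
Definition translate (v : V) (F : D) : D :=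
  direct_image_complex (@tau_continuous v) F.

Definition translate_hom (v : V) (F G : D) (f : derived_hom F G) :
    derived_hom (translate v F) (translate v G) :=
  direct_image_derived (direct_image_qis_homeo (@tau_continuous v)
    (@tau_continuous (- v)) (tauK v) (tauNK v)) f.

Lemma translate2S v (U : opens (cone_space t C)) :
  preimage_opens (@tau_continuous v) (preimage_opens (@tau_continuous v) U)
    `<=` preimage_opens (@tau_continuous (v *+ 2)) U.
Proof. by move=> x; rewrite /= /tau mulr2n opprD addrA. Qed.

Lemma translate2_res v (P : presheaf k (cone_space t C))
    (U W : opens (cone_space t C)) (WU : W `<=` U)
    (s : P (preimage_opens (@tau_continuous (v *+ 2)) U)) :
  res (translate2S (v := v) (U := W)) (res (preimageS (@tau_continuous _) WU) s) =
  res (preimageS (@tau_continuous v) (preimageS (@tau_continuous v) WU))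
    (res (translate2S (v := v) (U := U)) s).
Proof.
have h : preimage_opens (@tau_continuous v)
    (preimage_opens (@tau_continuous v) W) `<=`
    preimage_opens (@tau_continuous (v *+ 2)) U.
  exact: subset_trans (@translate2S v W) (preimageS (@tau_continuous _) WU).
by rewrite (res_comp _ _ h) (res_comp _ _ h).
Qed.

Lemma translate2_diff v (F : D) n (U : opens (cone_space t C))
    (s : translate (v *+ 2) F n U) :
  res (translate2S (v := v) (U := U)) (cdiff (translate (v *+ 2) F) n U s) =
  cdiff F n _ (res (translate2S (v := v) (U := U)) s).
Proof. exact/esym/hom_res. Qed.

(* The canonical isomorphism between tau_(2v)* and tau_v* tau_v*, which are not
   convertible: restriction along the equality of open sets (U + v) + v = U + 2v. *)
Definition translate2 v (F : D) :
    complex_hom (translate (v *+ 2) F) (translate v (translate v F)) :=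
  @ComplexHom k _ (translate (v *+ 2) F) (translate v (translate v F))
    (fun n => @PresheafHom k _ (translate (v *+ 2) F n)
      (translate v (translate v F) n)
      (fun U => res (translate2S (v := v) (U := U)))
      (@translate2_res v (F n)))
    (@translate2_diff v F).

Section Chi.
Variables (v : V) (Cv : antipode C v).

Lemma chiS (U : opens (cone_space t C)) :
  U `<=` preimage_opens (@tau_continuous v) U.
Proof.
have /cone_openP [_ UC] : cone_open t C U := opens_open U.
by have [w Cw <-] := Cv => x Ux; rewrite /= /tau opprK; exact: UC.
Qed.

Lemma chi_res (P : presheaf k (cone_space t C))
    (U W : opens (cone_space t C)) (WU : W `<=` U)
    (s : P (preimage_opens (@tau_continuous v) U)) :
  res (@chiS W) (res (preimageS (@tau_continuous _) WU) s) = res WU (res (@chiS U) s).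
Proof.
have h : W `<=` preimage_opens (@tau_continuous v) U.
  exact: subset_trans WU (@chiS U).
by rewrite !(res_comp _ _ h).
Qed.

Lemma chi_diff (F : D) n (U : opens (cone_space t C)) (s : translate v F n U) :
  res (@chiS U) (cdiff (translate v F) n U s) = cdiff F n U (res (@chiS U) s).
Proof. exact/esym/hom_res. Qed.

(* chi_(v,0)(F) : tau_v* F -> F, given by the restrictions F(U + v) -> F(U). As
   tau_v* is exact, no resolution of F is needed. *)
Definition chi (F : D) : complex_hom (translate v F) F :=
  @ComplexHom k _ (translate v F) F
    (fun n => @PresheafHom k _ (translate v F n) (F n)
      (fun U => res (@chiS U)) (@chi_res (F n)))
    (@chi_diff F).

End Chi.

Lemma antipode_mul2 v : antipode C v -> antipode C (v *+ 2).
Proof.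
move=> [w Cw <-]; exists (w *+ 2); last by rewrite mulNrn.
by rewrite -scaler_nat; apply: cone_scale.
Qed.

Definition interleaved (v : V) (F G : D) :=
  exists (Cv : antipode C v) (f : derived_hom (translate v F) G)
         (g : derived_hom (translate v G) F),
    derived_eq (dh_comp (dh_comp g (translate_hom v f)) (dh_map (translate2 v F)))
               (dh_map (chi (antipode_mul2 Cv) F)) /\
    derived_eq (dh_comp (dh_comp f (translate_hom v g)) (dh_map (translate2 v G)))
               (dh_map (chi (antipode_mul2 Cv) G)).

Definition interleaving_distance (v : V) (F G : D) : \bar R :=
  ereal_inf ([set c%:E | c in [set c : R | 0 <= c /\ interleaved (c *: v) F G]]
             `|` [set +oo%E]).

End ConeSpace.

Section Beta.
Variables (R : realType) (V : normedModType R) (C : cone V) (k : fieldType).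

Definition beta (x : cone_space Alexandrov C) : cone_space Gamma C := x.

Lemma beta_continuous : continuous beta.
Proof. by apply/continuousP => U [_ UC]. Qed.

(* beta_* is exact, so that it acts on the derived category termwise *)
Definition beta_direct_image (F : complex k (cone_space Alexandrov C)) :
    complex k (cone_space Gamma C) :=
  direct_image_complex beta_continuous F.

End Beta.

(* Main.v *)
Require Import Defs.
From HB Require Import structures.
From mathcomp Require Import all_boot all_order all_algebra.
From mathcomp Require Import all_classical all_reals.
From mathcomp Require Import ereal topology normedtype convex.

Set Implicit Arguments.
Unset Strict Implicit.
Unset Printing Implicit Defensive.

Import Order.TTheory GRing.Theory Num.Theory.
Import numFieldTopology.Exports numFieldNormedType.Exports.

Local Open Scope classical_set_scope.
Local Open Scope ring_scope.

(** Write L for beta_* and M for its left adjoint, the inverse image along beta;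
    both are exact, so they act termwise on complexes and pass to the derived
    categories, where morphisms are words in morphisms of complexes and inverses
    of quasi-isomorphisms. T_e is the translation by e, which acts on sheaves for
    both topologies.

    One inequality is formal. L commutes with translations up to an isomorphism
    given by restriction along an equality of open sets, so L sends a
    cv-interleaving to a cv-interleaving ([beta_interleaved]).

    For the other inequality, F cannot be recovered from L F: the counit
    M L F -> F is not an isomorphism in general, since at x it is the map
    colim F(U) -> F(x + gamma) over the gamma-open U containing x. But it
    becomes invertible up to an arbitrarily small shift. If d - e lies in the
    interior of gamma, then for every Alexandrov-open U the interior of U + e - d
    is gamma-open and contains U, so that restriction gives a morphism of
    complexes T_e F -> M T_d L F ([inner_germs_complex]). From
    f : T_d L F -> L G one therefore gets

      T_e F -> M T_d L F -> M L G -> G,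

    where the last two maps are M f and the counit ([lift_interleaving]). Taking
    d = cv and e = (c + a)v with a > 0 turns a cv-interleaving of L F and L G
    into a (c + a)v-interleaving of F and G, provided that the lifts of f and g
    still compose to chi ([lift_composite]). Three identities between morphisms
    of complexes give this:
    - the counit followed by [inner_germs_complex] is the morphism
      T_e M L G -> M T_d L G that moves germs by d - e ([shift_germs_complex]);
      such a morphism exists for every complex H in place of L G and is natural
      in H in the derived category, so T_e (M f) can be moved past it;
    - two successive inner restrictions are the inner restriction for the
      doubled vectors ([inner_germs_translate2]);
    - inner restriction, then M of chi, then the counit is chi ([counit_chi]).
    All maps involved are built from restrictions, so in each identity both sides
    are locally restrictions of one section. *)

(** * Restrictions and extensionality *)

(** Sections obtained from one section along two chains of inclusions agree. In
    this form the composite inclusion is not an argument, so that the lemmas apply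
    by unification when the open sets are iterated preimages. *)
Section Restrictions.
Variables (k : fieldType) (X : topologicalType) (P : presheaf k X).
Variables (U W W' Z : opens X) (WU : W `<=` U) (ZW : Z `<=` W).
Variables (WU' : W' `<=` U) (ZW' : Z `<=` W').

Lemma res_res2 (s : P U) : res ZW (res WU s) = res ZW' (res WU' s).
Proof. by rewrite !(res_comp _ _ (subset_trans ZW WU)). Qed.

Lemma res_res3 (A : opens X) (AZ : A `<=` Z) (AW' : A `<=` W') (s : P U) :
  res AZ (res ZW (res WU s)) = res AW' (res WU' s).
Proof.
rewrite (res_comp _ _ (subset_trans ZW WU)).
by rewrite !(res_comp _ _ (subset_trans AW' WU')).
Qed.

End Restrictions.

Section LongRestrictions.
Variables (k : fieldType) (X : topologicalType) (P : presheaf k X).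
Variables (U W Z A : opens X) (WU : W `<=` U) (ZW : Z `<=` W) (AZ : A `<=` Z).

Lemma res_comp3 (AU : A `<=` U) (s : P U) : res AZ (res ZW (res WU s)) = res AU s.
Proof. by rewrite (res_comp _ _ (subset_trans ZW WU)) (res_comp _ _ AU). Qed.

Lemma res_res43 (B W' Z' : opens X) (BA : B `<=` A) (WU' : W' `<=` U)
    (ZW' : Z' `<=` W') (BZ' : B `<=` Z') (s : P U) :
  res BA (res AZ (res ZW (res WU s))) = res BZ' (res ZW' (res WU' s)).
Proof.
rewrite (res_comp3 (subset_trans AZ (subset_trans ZW WU))).
rewrite (res_comp _ _ (subset_trans BA (subset_trans AZ (subset_trans ZW WU)))).
rewrite (res_comp _ _ (subset_trans ZW' WU')).
by rewrite (res_comp _ _ (subset_trans BA (subset_trans AZ (subset_trans ZW WU)))).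
Qed.

End LongRestrictions.

Lemma res_common (k : fieldType) (X : topologicalType) (P : presheaf k X)
    (U U' N J : opens X) (NU : N `<=` U) (NU' : N `<=` U') (JN : J `<=` N)
    (W W' : opens X) (WU : W `<=` U) (JW : J `<=` W) (WU' : W' `<=` U')
    (JW' : J `<=` W') (s : P U) (t : P U') :
  res NU s = res NU' t -> res JW (res WU s) = res JW' (res WU' t).
Proof.
move=> st; rewrite (res_res2 WU JW NU JN) st; exact: res_res2.
Qed.

Lemma linear_ext (k : fieldType) (A B : lmodType k) (f g : {linear A -> B}) :
  f =1 g -> f = g.
Proof.
move=> /funext; case: f g => [f [[fD] [fZ]]] [g [[gD] [gZ]]] /= fg; subst g.
by rewrite (Prop_irrelevance fD gD) (Prop_irrelevance fZ gZ).
Qed.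

Lemma presheaf_hom_ext (k : fieldType) (X : topologicalType)
    (P Q : presheaf k X) (f g : presheaf_hom P Q) :
  (forall U s, f U s = g U s) -> f = g.
Proof.
case: f g => [f fres] [g gres] /= fg.
have e : f = g.
  by apply: functional_extensionality_dep => U; exact/linear_ext/fg.
by subst g; rewrite (Prop_irrelevance fres gres).
Qed.

Lemma complex_hom_ext (k : fieldType) (X : topologicalType)
    (F G : complex k X) (f g : complex_hom F G) :
  (forall n U s, f n U s = g n U s) -> f = g.
Proof.
case: f g => [f fd] [g gd] /= fg.
have e : f = g.
  by apply: functional_extensionality_dep => n; exact/presheaf_hom_ext/fg.
by subst g; rewrite (Prop_irrelevance fd gd).
Qed.

(** * Exact functors on derived categories *)

Section DerivedSetoid.
Variables (k : fieldType) (X : topologicalType).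

#[export] Instance derived_eq_equivalence (F G : complex k X) :
  RelationClasses.Equivalence (@derived_eq k X F G).
Proof.
split; [exact: de_refl | exact: de_sym | exact: de_trans].
Qed.

#[export] Instance dh_comp_proper (F G H : complex k X) :
  Morphisms.Proper (Morphisms.respectful (@derived_eq k X G H)
    (Morphisms.respectful (@derived_eq k X F G) (@derived_eq k X F H)))
    (@dh_comp k X F G H).
Proof. by move=> g g' gg' f f' ff'; exact: de_comp. Qed.

End DerivedSetoid.
#[export] Hint Resolve de_refl : core.

(** A functor between categories of complexes which preserves quasi-isomorphisms
    descends to the localizations with no resolution: it can be applied letter by
    letter to a word. *)
Record exact_functor (k : fieldType) (X Y : topologicalType) := ExactFunctor {
  ef_obj :> complex k X -> complex k Y;
  ef_map : forall F G, complex_hom F G -> complex_hom (ef_obj F) (ef_obj G);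
  ef_id : forall F, ef_map (complex_id F) = complex_id (ef_obj F);
  ef_comp : forall F G H (g : complex_hom G H) (f : complex_hom F G),
    ef_map (complex_comp g f) = complex_comp (ef_map g) (ef_map f);
  ef_qis : forall F G (w : complex_hom F G),
    quasi_isomorphism w -> quasi_isomorphism (ef_map w) }.
Arguments ef_map {k X Y} e {F G} f.
Arguments ef_qis {k X Y} e {F G w} qw.

Section DerivedFunctor.
Variables (k : fieldType).

Fixpoint derived_functor (X Y : topologicalType) (Phi : exact_functor k X Y)
    (F G : complex k X) (u : derived_hom F G) : derived_hom (Phi F) (Phi G) :=
  match u with
  | dh_map _ _ f => dh_map (ef_map Phi f)
  | dh_inv _ _ _ qw => dh_inv (ef_qis Phi qw)
  | dh_comp _ _ _ g f => dh_comp (derived_functor Phi g) (derived_functor Phi f)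
  end.

Lemma derived_functor_eq (X Y : topologicalType) (Phi : exact_functor k X Y)
    (F G : complex k X) (u u' : derived_hom F G) :
  derived_eq u u' -> derived_eq (derived_functor Phi u) (derived_functor Phi u').
Proof.
elim=> {F G u u'} /=.
- by [].
- by move=> F G f g _; exact: de_sym.
- by move=> F G f g h _ fg _ gh; exact: de_trans fg gh.
- by move=> F G H g g' f f' _ gg' _ ff'; exact: de_comp.
- by move=> *; exact: de_assoc.
- by move=> F G f; rewrite ef_id; exact: de_idl.
- by move=> F G f; rewrite ef_id; exact: de_idr.
- by move=> F G H g f; rewrite ef_comp; exact: de_map.
- by move=> F G w qw; rewrite ef_id; exact: de_invl.
- by move=> F G w qw; rewrite ef_id; exact: de_invr.
Qed.

Section Composition.
Variables (X Y Z : topologicalType).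
Variables (Psi : exact_functor k Y Z) (Phi : exact_functor k X Y).

Lemma comp_ef_id (F : complex k X) :
  ef_map Psi (ef_map Phi (complex_id F)) = complex_id (Psi (Phi F)).
Proof. by rewrite !ef_id. Qed.

Lemma comp_ef_comp (F G H : complex k X) (g : complex_hom G H)
    (f : complex_hom F G) :
  ef_map Psi (ef_map Phi (complex_comp g f)) =
  complex_comp (ef_map Psi (ef_map Phi g)) (ef_map Psi (ef_map Phi f)).
Proof. by rewrite !ef_comp. Qed.

Definition comp_functor : exact_functor k X Z :=
  @ExactFunctor k X Z (fun F => Psi (Phi F))
    (fun F G f => ef_map Psi (ef_map Phi f)) comp_ef_id comp_ef_comp
    (fun F G w qw => ef_qis Psi (ef_qis Phi qw)).

Lemma derived_functor_comp (F G : complex k X) (u : derived_hom F G) :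
  derived_functor comp_functor u = derived_functor Psi (derived_functor Phi u).
Proof. by elim: u => //= F' G' H g -> f ->. Qed.

End Composition.

(** Naturality on morphisms of complexes is enough: a square that commutes for a
    quasi-isomorphism w also commutes for its formal inverse, by composing with
    the inverses of the images of w on both sides. *)
Lemma derived_natural (X Y : topologicalType) (Phi Psi : exact_functor k X Y)
    (alpha : forall F, complex_hom (Phi F) (Psi F)) :
  (forall F G (f : complex_hom F G),
    complex_comp (alpha G) (ef_map Phi f) =
    complex_comp (ef_map Psi f) (alpha F)) ->
  forall F G (u : derived_hom F G),
    derived_eq (dh_comp (dh_map (alpha G)) (derived_functor Phi u))
               (dh_comp (derived_functor Psi u) (dh_map (alpha F))).
Proof.
move=> nat F G; elim=> {F G} /= [F G f|F G w qw|F G H g IHg f IHf].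
- by rewrite !de_map nat.
- have e : derived_eq (dh_comp (dh_map (ef_map Psi w)) (dh_map (alpha F)))
      (dh_comp (dh_map (alpha G)) (dh_map (ef_map Phi w))).
    by rewrite !de_map nat.
  rewrite -[X in derived_eq X _]de_idl -(de_invl (ef_qis Psi qw)).
  rewrite -de_assoc; apply: de_comp => //.
  by rewrite de_assoc e -de_assoc de_invr de_idr.
- by rewrite de_assoc IHg -de_assoc IHf de_assoc.
Qed.

End DerivedFunctor.

Section DirectImageFunctor.
Variables (k : fieldType) (X Y : topologicalType) (f : X -> Y).
Hypothesis cf : continuous f.
Hypothesis direct_image_qis : forall (F G : complex k X) (w : complex_hom F G),
  quasi_isomorphism w -> quasi_isomorphism (direct_image_complex_hom cf w).

Lemma direct_image_complex_id (F : complex k X) :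
  direct_image_complex_hom cf (complex_id F) =
  complex_id (direct_image_complex cf F).
Proof. exact: complex_hom_ext. Qed.

Lemma direct_image_complex_comp (F G H : complex k X) (g : complex_hom G H)
    (h : complex_hom F G) :
  direct_image_complex_hom cf (complex_comp g h) =
  complex_comp (direct_image_complex_hom cf g) (direct_image_complex_hom cf h).
Proof. exact: complex_hom_ext. Qed.

Definition direct_image_functor : exact_functor k X Y :=
  ExactFunctor direct_image_complex_id direct_image_complex_comp
    direct_image_qis.

Lemma derived_direct_image (F G : complex k X) (u : derived_hom F G) :
  derived_functor direct_image_functor u =
  direct_image_derived direct_image_qis u.
Proof. by elim: u => //= F' G' H g -> h ->. Qed.

End DirectImageFunctor.

(** * The inverse image of a complex of sheaves *)

Section ModuleProduct.
Variables (k : fieldType) (I : Type) (M : I -> lmodType k).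

Definition module_product := forall i, M i.

HB.instance Definition _ := gen_eqMixin module_product.
HB.instance Definition _ := gen_choiceMixin module_product.

Let add (s t : module_product) : module_product := fun i => s i + t i.
Let opp (s : module_product) : module_product := fun i => - s i.
Let zero : module_product := fun=> 0.
Let scale (a : k) (s : module_product) : module_product := fun i => a *: s i.

Lemma module_product_ext (s t : module_product) : (forall i, s i = t i) -> s = t.
Proof. exact: functional_extensionality_dep. Qed.

Let addA : associative add.
Proof. by move=> s t u; apply: module_product_ext => i; exact: addrA. Qed.
Let addC : commutative add.
Proof. by move=> s t; apply: module_product_ext => i; exact: addrC. Qed.
Let add0 : left_id zero add.
Proof. by move=> s; apply: module_product_ext => i; exact: add0r. Qed.
Let addN : left_inverse zero opp add.
Proof. by move=> s; apply: module_product_ext => i; exact: addNr. Qed.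

HB.instance Definition _ :=
  GRing.isZmodule.Build module_product addA addC add0 addN.

Let scaleA a b s : scale a (scale b s) = scale (a * b) s.
Proof. by apply: module_product_ext => i; exact: scalerA. Qed.
Let scale1 : left_id 1 scale.
Proof. by move=> s; apply: module_product_ext => i; exact: scale1r. Qed.
Let scaleDr : right_distributive scale +%R.
Proof. by move=> a s t; apply: module_product_ext => i; exact: scalerDr. Qed.
Let scaleDl s : {morph scale^~ s : a b / a + b}.
Proof. by move=> a b; apply: module_product_ext => i; exact: scalerDl. Qed.

HB.instance Definition _ := GRing.Zmodule_isLmodule.Build k module_product
  scaleA scale1 scaleDr scaleDl.

End ModuleProduct.

Section InverseImage.
Variables (k : fieldType) (X Y : topologicalType) (f : X -> Y).
Hypothesis cf : continuous f.

Section Sections.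
Variables (P : presheaf k Y) (U : opens X).

Definition germ_family :=
  module_product (fun x : {x | oset U x} => stalk P (f (sval x))).

(** These families of germs form the sheafification of the presheaf inverse image:
    near each point the family comes from a single section of P on an open set of
    Y. Using germs avoids the colimit over the open sets of Y that contain the
    image of U. *)
Definition locally_germ (s : germ_family) := forall x, oset U x ->
  exists (N : opens X) (NU : N `<=` U) (W : opens Y)
         (NW : N `<=` preimage_opens cf W) (t : P W),
    oset N x /\ forall y (Ny : oset N y),
      s (exist _ y (NU y Ny)) = germ (NW y Ny : oset W (f y)) t.

Definition locally_germ_pred : pred germ_family :=
  fun s => `[< locally_germ s >].

Lemma locally_germ_submod : GRing.submod_closed locally_germ_pred.
Proof.
split=> [|a s t /asboolP ls /asboolP lt]; apply/asboolP => x Ux.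
  exists U, (@subset_refl _ _), (Opens openT), (@subsetT _ _), 0; split=> //.
  by move=> y Uy; rewrite germ0.
have [N [NU [W [NW [s' [Nx es]]]]]] := ls x Ux.
have [L [LU [Z [LZ [t' [Lx et]]]]]] := lt x Ux.
have IN : opensI N L `<=` N by move=> ? [].
have IL : opensI N L `<=` L by move=> ? [].
have IW : opensI W Z `<=` W by move=> ? [].
have IZ : opensI W Z `<=` Z by move=> ? [].
have IWZ : opensI N L `<=` preimage_opens cf (opensI W Z).
  by move=> y [/NW ? /LZ ?].
exists (opensI N L), (subset_trans IN NU), (opensI W Z), IWZ,
  (a *: res IW s' + res IZ t'); split=> // y Iy.
rewrite -[LHS]/(a *: s _ + t _) germP.
rewrite (germ_res (NW _ (IN _ Iy) : oset W (f y)) _ IW).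
rewrite (germ_res (LZ _ (IL _ Iy) : oset Z (f y)) _ IZ) -es -et.
rewrite (Prop_irrelevance (NU y _) (subset_trans IN NU Iy)).
by rewrite (Prop_irrelevance (LU y _) (subset_trans IN NU Iy)).
Qed.

HB.instance Definition _ := GRing.isSubmodClosed.Build k germ_family
  locally_germ_pred locally_germ_submod.

Definition inverse_sections := {s : germ_family | locally_germ_pred s}.

HB.instance Definition _ := SubType.on inverse_sections.
HB.instance Definition _ := [Choice of inverse_sections by <:].
HB.instance Definition _ := [SubChoice_isSubZmodule of inverse_sections by <:].
HB.instance Definition _ := [SubZmodule_isSubLmodule of inverse_sections by <:].

Definition germ_at (s : inverse_sections) x (Ux : oset U x) : stalk P (f x) :=
  val s (exist _ x Ux).
Arguments germ_at s {x} Ux.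

Lemma inverse_ext (s t : inverse_sections) :
  (forall x (Ux : oset U x), germ_at s Ux = germ_at t Ux) -> s = t.
Proof.
by move=> st; apply/val_inj/module_product_ext => -[x Ux]; exact: st.
Qed.

Lemma germ_at_irr (s : inverse_sections) x (Ux Ux' : oset U x) :
  germ_at s Ux = germ_at s Ux'.
Proof. by rewrite (Prop_irrelevance Ux Ux'). Qed.

Definition family_sections (s : forall x, oset U x -> stalk P (f x))
    (ls : locally_germ (fun x => s (sval x) (proj2_sig x))) : inverse_sections :=
  exist (fun s => locally_germ_pred s) (fun x => s (sval x) (proj2_sig x))
    (asboolT ls).

End Sections.
Arguments germ_at {P U} s {x} Ux.

Section SectionGerms.
Variables (P : presheaf k Y) (U : opens X) (W : opens Y).
Hypothesis UW : U `<=` preimage_opens cf W.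

Lemma section_germs_local (t : P W) :
  @locally_germ P U (fun x => germ (UW (proj2_sig x) : oset W (f (sval x))) t).
Proof.
move=> x Ux; exists U, (@subset_refl _ _), W, UW, t; split=> // y Uy.
by congr (germ _ _); exact: Prop_irrelevance.
Qed.

Definition section_germs (t : P W) : inverse_sections P U :=
  @family_sections P U (fun x Ux => germ (UW Ux : oset W (f x)) t)
    (section_germs_local t).

Lemma section_germs_linear : linear section_germs.
Proof. by move=> a s t; apply: inverse_ext => x Ux; exact: germP. Qed.

HB.instance Definition _ := GRing.isLinear.Build k (P W)
  (inverse_sections P U) *:%R section_germs section_germs_linear.

Lemma germ_at_section x (Ux : oset U x) (Wfx : oset W (f x)) (t : P W) :
  germ_at (section_germs t) Ux = germ Wfx t.
Proof. by rewrite (Prop_irrelevance Wfx (UW Ux)). Qed.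

End SectionGerms.

Section Restriction.
Variables (P : presheaf k Y) (U N : opens X) (NU : N `<=` U).

Lemma inverse_res_local (s : inverse_sections P U) :
  @locally_germ P N (fun x => germ_at s (NU (proj2_sig x))).
Proof.
move=> x Nx.
have [L [LU [W [LW [t [Lx e]]]]]] := asboolW (valP s) x (NU Nx).
have IN : opensI N L `<=` N by move=> ? [].
have IL : opensI N L `<=` L by move=> ? [].
exists (opensI N L), IN, W, (subset_trans IL LW), t; split=> // y Iy.
have := e y (IL _ Iy); rewrite (Prop_irrelevance (LU _ _) (NU (IN _ Iy))).
by move=> {}e; rewrite [LHS]e; congr (germ _ _); exact: Prop_irrelevance.
Qed.

Definition inverse_res (s : inverse_sections P U) : inverse_sections P N :=
  @family_sections P N (fun x Nx => germ_at s (NU Nx)) (inverse_res_local s).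

Lemma germ_at_res (s : inverse_sections P U) x (Nx : oset N x)
    (Ux : oset U x) :
  germ_at (inverse_res s) Nx = germ_at s Ux.
Proof. by rewrite (Prop_irrelevance Ux (NU Nx)). Qed.

Lemma inverse_res_linear : linear inverse_res.
Proof. by move=> a s t; exact: inverse_ext. Qed.

HB.instance Definition _ := GRing.isLinear.Build k (inverse_sections P U)
  (inverse_sections P N) *:%R inverse_res inverse_res_linear.

End Restriction.

Lemma inverse_local (P : presheaf k Y) (U : opens X)
    (s : inverse_sections P U) x : oset U x ->
  exists (N : opens X) (NU : N `<=` U) (W : opens Y)
         (NW : N `<=` preimage_opens cf W) (t : P W),
    oset N x /\ inverse_res NU s = section_germs NW t.
Proof.
move=> Ux; have [N [NU [W [NW [t [Nx e]]]]]] := asboolW (valP s) x Ux.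
by exists N, NU, W, NW, t; split=> //; exact: inverse_ext.
Qed.

Lemma section_germs_res (P : presheaf k Y) (N : opens X) (W Z : opens Y)
    (NW : N `<=` preimage_opens cf W) (NZ : N `<=` preimage_opens cf Z)
    (ZW : Z `<=` W) (t : P W) :
  section_germs NZ (res ZW t) = section_germs NW t.
Proof. by apply: inverse_ext => x Nx; exact: germ_res. Qed.

Lemma section_germs_eq (P : presheaf k Y) (N : opens X) (W W' Z : opens Y)
    (NW : N `<=` preimage_opens cf W) (NW' : N `<=` preimage_opens cf W')
    (NZ : N `<=` preimage_opens cf Z) (ZW : Z `<=` W) (ZW' : Z `<=` W')
    (s : P W) (t : P W') :
  res ZW s = res ZW' t -> section_germs NW s = section_germs NW' t.
Proof.
by move=> st; rewrite -(section_germs_res NW NZ ZW) st section_germs_res.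
Qed.

Lemma inverse_res_section (P : presheaf k Y) (U N : opens X) (W : opens Y)
    (NU : N `<=` U) (UW : U `<=` preimage_opens cf W)
    (NW : N `<=` preimage_opens cf W) (t : P W) :
  inverse_res NU (section_germs UW t) = section_germs NW t.
Proof. by apply: inverse_ext => x Nx; exact: germ_at_section. Qed.

Lemma inverse_res_id (P : presheaf k Y) (U : opens X) (UU : U `<=` U)
    (s : inverse_sections P U) : inverse_res UU s = s.
Proof. by apply: inverse_ext => x Ux; exact: germ_at_res. Qed.

Lemma inverse_res_comp (P : presheaf k Y) (U N L : opens X) (NU : N `<=` U)
    (LN : L `<=` N) (LU : L `<=` U) (s : inverse_sections P U) :
  inverse_res LN (inverse_res NU s) = inverse_res LU s.
Proof.
apply: inverse_ext => x Lx.
by rewrite (germ_at_res _ _ _ (LN x Lx)) !(germ_at_res _ _ _ (LU x Lx)).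
Qed.

Definition inverse_presheaf (P : presheaf k Y) : presheaf k X :=
  @Presheaf k X (fun U => inverse_sections P U) (fun U N NU => inverse_res NU)
    (@inverse_res_id P) (@inverse_res_comp P).

Lemma inverse_is_sheaf (P : presheaf k Y) : is_sheaf (inverse_presheaf P).
Proof.
move=> I U W UW WU; split=> [s t st|s sE].
  apply: inverse_ext => x Wx; have [i _ Uix] := WU x Wx.
  have /(congr1 (fun u => germ_at u Uix)) := st i.
  by rewrite !(germ_at_res _ _ _ Wx).
have ix x (Wx : oset W x) : {i | oset (U i) x}.
  by apply: cid; have [i _ Uix] := WU x Wx; exists i.
have sij i j x (Ui : oset (U i) x) (Uj : oset (U j) x) :
    germ_at (s i) Ui = germ_at (s j) Uj.
  have /(congr1 (fun u : inverse_sections P (opensI (U i) (U j)) =>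
    germ_at u (conj Ui Uj))) := sE i j.
  by rewrite (germ_at_res _ _ _ Ui) (germ_at_res _ _ _ Uj).
have lt : @locally_germ P W (fun x =>
    germ_at (s (projT1 (ix (sval x) (proj2_sig x))))
      (projT2 (ix _ (proj2_sig x)))).
  move=> x Wx; have [i _ Uix] := WU x Wx.
  have [N [NU [Z [NZ [t [Nx e]]]]]] := inverse_local (s i) Uix.
  exists N, (subset_trans NU (UW i)), Z, NZ, t; split=> // y Ny /=.
  have /(congr1 (fun u => germ_at u Ny)) := e; rewrite [in RHS]/germ_at /= => <-.
  exact: sij.
pose t := @family_sections P W (fun x Wx =>
  germ_at (s (projT1 (ix x Wx))) (projT2 (ix x Wx))) lt.
by exists t => i; apply: inverse_ext => x Uix; exact: sij.
Qed.

Definition inverse_sheaf (P : presheaf k Y) : sheaf k X :=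
  Sheaf (inverse_is_sheaf P).

Section Morphism.
Variables (P Q : presheaf k Y) (g : presheaf_hom P Q).

Lemma inverse_map_local (U : opens X) (s : inverse_sections P U) :
  @locally_germ Q U (fun x => stalk_map g _ (germ_at s (proj2_sig x))).
Proof.
move=> x Ux; have [N [NU [W [NW [t [Nx e]]]]]] := inverse_local s Ux.
exists N, NU, W, NW, (g W t); split=> // y Ny /=.
have /(congr1 (fun u => germ_at u Ny)) := e.
rewrite [in RHS]/germ_at /= -(stalk_mapE g (NW y Ny : oset W (f y))) => <-.
by congr (stalk_map _ _ _); exact: germ_at_irr.
Qed.

Definition inverse_map (U : opens X) (s : inverse_sections P U) :
    inverse_sections Q U :=
  @family_sections Q U (fun x Ux => stalk_map g (f x) (germ_at s Ux))
    (inverse_map_local s).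

Lemma inverse_map_linear U : linear (@inverse_map U).
Proof. by move=> a s t; apply: inverse_ext => x Ux; exact: linearP. Qed.

HB.instance Definition _ U := GRing.isLinear.Build k (inverse_sections P U)
  (inverse_sections Q U) *:%R (@inverse_map U) (@inverse_map_linear U).

Lemma inverse_map_res (U N : opens X) (NU : N `<=` U)
    (s : inverse_sections P U) :
  inverse_map (inverse_res NU s) = inverse_res NU (inverse_map s).
Proof. exact: inverse_ext. Qed.

Definition inverse_hom : presheaf_hom (inverse_sheaf P) (inverse_sheaf Q) :=
  @PresheafHom k X (inverse_sheaf P) (inverse_sheaf Q)
    (fun U => @inverse_map U) inverse_map_res.

Lemma inverse_map_section (U : opens X) (W : opens Y)
    (UW : U `<=` preimage_opens cf W) (t : P W) :
  inverse_map (section_germs UW t) = section_germs UW (g W t).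
Proof. by apply: inverse_ext => x Ux; exact: stalk_mapE. Qed.

End Morphism.

Section InverseComplex.
Variable F : complex k Y.

Lemma inverse_diffK n (U : opens X) (s : inverse_sections (F n) U) :
  inverse_map (cdiff F (n + 1)) (inverse_map (cdiff F n) s) = 0.
Proof.
apply: inverse_ext => x Ux.
rewrite -[LHS]/(stalk_map _ _ (stalk_map _ _ (germ_at s Ux))).
have [W [Wx [t ->]]] := germ_surj (germ_at s Ux).
by rewrite !stalk_mapE cdiffK germ0.
Qed.

Definition inverse_complex : complex k X :=
  @Complex k X (fun n => inverse_sheaf (F n))
    (fun n => inverse_hom (cdiff F n)) inverse_diffK.

End InverseComplex.

Section InverseComplexMap.
Variables (F G : complex k Y) (u : complex_hom F G).

Lemma inverse_cmap_diff n (U : opens X) (s : inverse_sections (F n) U) :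
  inverse_map (u (n + 1)) (inverse_map (cdiff F n) s) =
  inverse_map (cdiff G n) (inverse_map (u n) s).
Proof.
apply: inverse_ext => x Ux.
rewrite -[LHS]/(stalk_map _ _ (stalk_map _ _ (germ_at s Ux))).
rewrite -[RHS]/(stalk_map _ _ (stalk_map _ _ (germ_at s Ux))).
have [W [Wx [t ->]]] := germ_surj (germ_at s Ux).
by rewrite !stalk_mapE cmap_diff.
Qed.

Definition inverse_complex_hom :
    complex_hom (inverse_complex F) (inverse_complex G) :=
  @ComplexHom k X (inverse_complex F) (inverse_complex G)
    (fun n => inverse_hom (u n)) inverse_cmap_diff.

(** The inverse image is exact because its local sections are germs of sections of
    the original sheaf: a relation between germs at f x already holds on an open
    set of Y, where the hypothesis on u applies, and the primitive or the lifted
    cocycle found there is pulled back. *)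
Lemma inverse_qis : quasi_isomorphism u -> quasi_isomorphism inverse_complex_hom.
Proof.
move=> /quasi_isomorphismP qu; apply/quasi_isomorphismP => n.
have [uinj usurj] := qu n; split.
  move=> U s t ds e x Ux.
  have [N [NU [W [NW [s0 [Nx es]]]]]] := inverse_local s Ux.
  have [L [LU [Z [LZ [t0 [Lx et]]]]]] := inverse_local t Ux.
  have Wfx : oset W (f x) := NW x Nx.
  have Zfx : oset Z (f x) := LZ x Lx.
  have gs : germ_at s Ux = germ Wfx s0.
    by rewrite -(germ_at_section NW Nx) -es germ_at_res.
  have gt : germ_at t Ux = germ Zfx t0.
    by rewrite -(germ_at_section LZ Lx) -et germ_at_res.
  have /(congr1 (fun u => germ_at u Ux)) := ds.
  rewrite -[LHS]/(stalk_map _ _ (germ_at s Ux)) gs stalk_mapE.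
  rewrite -[RHS](germ0 _ (Wfx : oset W (f x))).
  move=> /germ_eq [A [Ax [AW [AW' eA]]]]; rewrite linear0 in eA.
  have /(congr1 (fun u => germ_at u Ux)) := e.
  rewrite -[LHS]/(stalk_map _ _ (germ_at s Ux)) gs stalk_mapE.
  rewrite -[RHS]/(stalk_map _ _ (germ_at t Ux)) gt stalk_mapE.
  move=> /germ_eq [B [Bx [BW [BZ eB]]]].
  (* d s0 vanishes on A and u s0 is the coboundary of t0 on B *)
  pose I := opensI A B.
  have IA : I `<=` A by move=> ? [].
  have IB : I `<=` B by move=> ? [].
  pose s1 := res (subset_trans IB BW) s0.
  pose t1 := res (subset_trans IB BZ) t0.
  have ds1 : cdiff F (n + 1) I s1 = 0.
    rewrite hom_res (res_irr _ (subset_trans IA AW)) -(res_comp AW IA) eA.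
    by rewrite linear0.
  have es1 : u (n + 1) I s1 = cdiff G n I t1.
    by rewrite !hom_res -(res_comp BW IB) eB (res_comp BZ IB (subset_trans IB BZ)).
  have [C [CI [v [Cx ev]]]] := uinj I s1 t1 ds1 es1 (f x) (conj Ax Bx).
  have KN : opensI N (preimage_opens cf C) `<=` N by move=> ? [].
  have KC : opensI N (preimage_opens cf C) `<=` preimage_opens cf C.
    by move=> ? [].
  exists (opensI N (preimage_opens cf C)), (subset_trans KN NU),
    (section_germs KC v); split=> //.
  have KI : opensI N (preimage_opens cf C) `<=` preimage_opens cf I.
    by move=> y /KC /CI.
  have KW := subset_trans KN NW.
  rewrite [RHS](inverse_map_section (cdiff F n)) -ev (section_germs_res KI).
  rewrite (section_germs_res KW) -(inverse_res_section KN NW) -es.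
  exact/esym/inverse_res_comp.
move=> U t dt x Ux.
have [N [NU [W [NW [t0 [Nx et]]]]]] := inverse_local t Ux.
have Wfx : oset W (f x) := NW x Nx.
have gt : germ_at t Ux = germ Wfx t0.
  by rewrite -(germ_at_section NW Nx) -et germ_at_res.
have /(congr1 (fun u => germ_at u Ux)) := dt.
rewrite -[LHS]/(stalk_map _ _ (germ_at t Ux)) gt stalk_mapE.
rewrite -[RHS](germ0 _ (Wfx : oset W (f x))).
move=> /germ_eq [A [Ax [AW [AW' eA]]]]; rewrite linear0 in eA.
have dt1 : cdiff G (n + 1) A (res AW t0) = 0 by rewrite hom_res.
have [C [CA [s [v [Cx ds ev]]]]] := usurj A _ dt1 (f x) Ax.
have KN : opensI N (preimage_opens cf C) `<=` N by move=> ? [].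
have KC : opensI N (preimage_opens cf C) `<=` preimage_opens cf C.
  by move=> ? [].
have KA : opensI N (preimage_opens cf C) `<=` preimage_opens cf A.
  by move=> y /KC /CA.
exists (opensI N (preimage_opens cf C)), (subset_trans KN NU),
  (section_germs KC s), (section_germs KC v); split=> //.
  by rewrite [LHS](inverse_map_section (cdiff F (n + 1))) ds linear0.
rewrite [RHS](inverse_map_section (cdiff G n)) -ev linearB /=.
rewrite [X in X - _ = _](inverse_map_section (u (n + 1))); congr (_ - _).
rewrite (section_germs_res KA) (section_germs_res (subset_trans KN NW)).
rewrite -(inverse_res_section KN NW) -et; exact/esym/inverse_res_comp.
Qed.

End InverseComplexMap.

Lemma inverse_complex_id (F : complex k Y) :
  inverse_complex_hom (complex_id F) = complex_id (inverse_complex F).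
Proof.
apply: complex_hom_ext => n U s; apply: inverse_ext => x Ux.
rewrite -[LHS]/(stalk_map _ _ (germ_at s Ux)).
rewrite -[RHS]/(germ_at s Ux).
by have [W [Wx [t ->]]] := germ_surj (germ_at s Ux); rewrite stalk_mapE.
Qed.

Lemma inverse_complex_comp (F G H : complex k Y) (g : complex_hom G H)
    (h : complex_hom F G) :
  inverse_complex_hom (complex_comp g h) =
  complex_comp (inverse_complex_hom g) (inverse_complex_hom h).
Proof.
apply: complex_hom_ext => n U s; apply: inverse_ext => x Ux.
rewrite -[LHS]/(stalk_map _ _ (germ_at s Ux)).
rewrite -[RHS]/(stalk_map _ _ (stalk_map _ _ (germ_at s Ux))).
by have [W [Wx [t ->]]] := germ_surj (germ_at s Ux); rewrite !stalk_mapE.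
Qed.

Definition inverse_functor : exact_functor k Y X :=
  ExactFunctor inverse_complex_id inverse_complex_comp inverse_qis.

End InverseImage.

(** * The counit of the inverse image adjunction *)

Section StalkTransport.
Variables (k : fieldType) (X Y : topologicalType).
Variables (P : presheaf k X) (Q : presheaf k Y) (x : X) (y : Y).
Variable psi : opens X -> opens Y.
Hypothesis psiS : forall U W : opens X, W `<=` U -> psi W `<=` psi U.
Hypothesis psi_mem : forall U : opens X, oset U x -> oset (psi U) y.
Variable phi : forall U : opens X, {linear P U -> Q (psi U)}.
Hypothesis phi_res : forall (U W : opens X) (WU : W `<=` U) (s : P U),
  phi W (res WU s) = res (psiS WU) (phi U s).

(** The form needed both for the pullback of germs along a continuous map and for
    their displacement by a vector: psi tells on which open set the transported
    section lives. *)
Definition ls_transport (s : germ_premodule P x) : germ_premodule Q y :=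
  LocalSection (psi_mem (ls_mem s)) (phi _ (ls_sec s)).

Lemma ls_transport_eqv s t :
  pm_eqv s t -> pm_eqv (ls_transport s) (ls_transport t).
Proof.
move=> [W [Wx [Ws [Wt e]]]].
exists (psi W), (psi_mem Wx), (psiS Ws), (psiS Wt) => /=.
by rewrite -!phi_res e.
Qed.

Lemma ls_transport_linear a s t :
  pm_eqv (ls_transport (pm_add (pm_scale a s) t))
         (pm_add (pm_scale a (ls_transport s)) (ls_transport t)).
Proof.
pose I := opensI (ls_dom s) (ls_dom t).
have Is : I `<=` ls_dom s by move=> ? [].
have It : I `<=` ls_dom t by move=> ? [].
have h : psi I `<=` opensI (psi (ls_dom s)) (psi (ls_dom t)).
  by move=> z Iz; split; [exact: (psiS Is) | exact: (psiS It)].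
exists (psi I), (psi_mem (conj (ls_mem s) (ls_mem t) : oset I x)).
exists (@subset_refl _ _), h.
rewrite /= res_id !linearD /= !phi_res !linearZ /=.
rewrite !(res_comp _ h (psiS Is)) !(res_comp _ h (psiS It)).
by congr (_ *: _ + _); exact: res_irr.
Qed.

Definition stalk_transport : {linear stalk P x -> stalk Q y} :=
  quotient_map (PremoduleHom ls_transport_eqv ls_transport_linear).

Lemma stalk_transportE (U : opens X) (Ux : oset U x) (s : P U) :
  stalk_transport (germ Ux s) = germ (psi_mem Ux) (phi U s).
Proof. exact: quotient_mapE. Qed.

End StalkTransport.

Section SheafGerms.
Variables (k : fieldType) (X : topologicalType) (F : sheaf k X).

Lemma sheaf_germ_ext (U : opens X) (s t : F U) :
  (forall x (Ux : oset U x), germ Ux s = germ Ux t) -> s = t.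
Proof.
move=> st.
have near_eq (i : {x | oset U x}) : {W : {W : opens X | W `<=` U} |
    oset (sval W) (sval i) /\ res (proj2_sig W) s = res (proj2_sig W) t}.
  apply: cid; case: i => x Ux.
  have /germ_eq [W [Wx [WU [WU' e]]]] := st x Ux.
  by exists (exist _ W WU); split=> //; rewrite /= e; exact: res_irr.
have UW : U `<=` \bigcup_i sval (sval (near_eq i)).
  by move=> x Ux; exists (exist _ x Ux) => //; case: (near_eq _) => W [].
have [sep _] := @sheafP _ _ F _ _ _ (fun i => proj2_sig (sval (near_eq i))) UW.
by apply: sep => i; case: (near_eq i) => W [].
Qed.

(** A sheaf is its own associated sheaf. *)
Lemma sheaf_germ_glue (U : opens X) (s : forall x, oset U x -> stalk F x) :
  locally_section s ->
  exists t : F U, forall x (Ux : oset U x), germ Ux t = s x Ux.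
Proof.
move=> ls.
have loc (i : {x | oset U x}) : {W : {W : opens X & {WU : W `<=` U & F W}} |
    oset (projT1 W) (sval i) /\
    forall y (Wy : oset (projT1 W) y),
      s y (projT1 (projT2 W) y Wy) = germ Wy (projT2 (projT2 W))}.
  apply: cid; case: i => x Ux; have [W [WU [t [Wx e]]]] := ls x Ux.
  by exists (existT _ W (existT _ WU t)).
pose W i := projT1 (sval (loc i)).
have WU i : W i `<=` U := projT1 (projT2 (sval (loc i))).
pose t i : F (W i) := projT2 (projT2 (sval (loc i))).
have tE i y (Wy : oset (W i) y) (Uy : oset U y) : germ Wy (t i) = s y Uy.
  have [_ e] := proj2_sig (loc i).
  by rewrite -e; congr (s y _); exact: Prop_irrelevance.
have UW : U `<=` \bigcup_i W i.
  move=> x Ux; exists (exist _ x Ux) => //.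
  by case: (proj2_sig (loc (exist _ x Ux))).
have [_ glue] := @sheafP _ _ F _ _ _ WU UW.
have [r rE] : exists r : F U, forall i, res (WU i) r = t i.
  apply: glue => i j; apply: sheaf_germ_ext => x [Wi Wj].
  by rewrite (germ_res Wi) (germ_res Wj) !(tE _ _ _ (WU i x Wi)).
exists r => x Ux; have [i _ Wi] := UW x Ux.
by rewrite -(germ_res Ux Wi (WU i)) rE; exact: tE.
Qed.

End SheafGerms.

Section Counit.
Variables (k : fieldType) (X Y : topologicalType) (f : X -> Y).
Hypothesis cf : continuous f.

Definition stalk_pullback (P : presheaf k X) (x : X) :
    {linear stalk (direct_image_presheaf cf P) (f x) -> stalk P x} :=
  @stalk_transport k Y X (direct_image_presheaf cf P) P (f x) x
    (preimage_opens cf) (fun U W WU => preimageS cf WU) (fun U Ux => Ux)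
    (fun U => idfun) (fun U W WU s => erefl).

Lemma stalk_pullbackE (P : presheaf k X) (x : X) (W : opens Y)
    (Wfx : oset W (f x)) (Wx : oset (preimage_opens cf W) x)
    (s : P (preimage_opens cf W)) :
  stalk_pullback P x (germ (P := direct_image_presheaf cf P) Wfx s) = germ Wx s.
Proof.
rewrite (Prop_irrelevance Wx Wfx).
exact: (@stalk_transportE _ _ _ (direct_image_presheaf cf P) P).
Qed.

Section Sheaf.
Variable F : sheaf k X.
Local Notation sections U := (inverse_sections cf (direct_image cf F) U).

Lemma counit_local (U : opens X) (s : sections U) :
  @locally_section k X F U (fun x Ux => stalk_pullback F x (germ_at s Ux)).
Proof.
move=> x Ux; have [N [NU [W [NW [t [Nx e]]]]]] := inverse_local s Ux.
exists N, NU, (res NW t); split=> // y Ny.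
rewrite -(germ_at_res NU s Ny) e (germ_at_section NW Ny (NW y Ny : oset W (f y))).
by rewrite (stalk_pullbackE _ (NW y Ny)) (germ_res (NW y Ny)).
Qed.

(** The germs of s at the points of U, pulled back to X, are locally the germs of
    a section of F, hence glue to a section since F is a sheaf. *)
Definition counit (U : opens X) (s : sections U) : F U :=
  projT1 (cid (sheaf_germ_glue (counit_local s))).

Lemma germ_counit (U : opens X) (s : sections U) x (Ux : oset U x) :
  germ Ux (counit s) = stalk_pullback F x (germ_at s Ux).
Proof. by rewrite /counit; case: cid => t /= ->. Qed.

Lemma counit_linear U : linear (@counit U).
Proof.
move=> a s t; apply: sheaf_germ_ext => x Ux.
by rewrite germP !germ_counit -linearP.
Qed.

HB.instance Definition _ U := GRing.isLinear.Build k (sections U) (F U) *:%R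
  (@counit U) (@counit_linear U).

Lemma counit_res (U N : opens X) (NU : N `<=` U) (s : sections U) :
  counit (inverse_res NU s) = res NU (counit s).
Proof.
apply: sheaf_germ_ext => x Nx; rewrite germ_counit (germ_res (NU x Nx)).
by rewrite germ_counit (germ_at_res _ _ _ (NU x Nx)).
Qed.

Lemma counit_section (U : opens X) (W : opens Y)
    (UW : U `<=` preimage_opens cf W) (t : F (preimage_opens cf W)) :
  counit (section_germs (P := direct_image cf F) UW t) = res UW t.
Proof.
apply: sheaf_germ_ext => x Ux.
rewrite germ_counit (germ_at_section UW Ux (UW x Ux : oset W (f x))).
by rewrite (stalk_pullbackE _ (UW x Ux)) (germ_res (UW x Ux)).
Qed.

Definition counit_hom :
    presheaf_hom (inverse_sheaf cf (direct_image cf F)) F :=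
  @PresheafHom k X (inverse_sheaf cf (direct_image cf F)) F
    (fun U => @counit U) counit_res.

End Sheaf.

Lemma counit_natural (F G : sheaf k X) (g : presheaf_hom F G) (U : opens X)
    (s : inverse_sections cf (direct_image cf F) U) :
  counit (inverse_map (direct_image_hom cf g) s : 
    inverse_sections cf (direct_image cf G) U) = g U (counit s).
Proof.
apply: sheaf_germ_ext => x Ux; rewrite germ_counit -stalk_mapE germ_counit.
rewrite -[germ_at _ _]/(stalk_map _ _ (germ_at s Ux)).
have [W [Wx [t ->]]] := germ_surj (germ_at s Ux).
rewrite stalk_mapE !(stalk_pullbackE _ (Wx : oset (preimage_opens cf W) x)).
by rewrite stalk_mapE.
Qed.

Definition counit_complex (F : complex k X) :
    complex_hom (inverse_complex cf (direct_image_complex cf F)) F :=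
  @ComplexHom k X (inverse_complex cf (direct_image_complex cf F)) F
    (fun n => counit_hom (F n))
    (fun n U s => counit_natural (cdiff F n) s).

End Counit.

(** * Interiors of Alexandrov-open sets *)

Section Cone.
Variables (R : realType) (V : normedModType R) (C : cone V).
Local Notation Xa := (cone_space Alexandrov C).
Local Notation Xg := (cone_space Gamma C).

Lemma cone_opens_add (t : cone_topology) (U : opens (cone_space t C)) (x c : V) :
  oset U x -> cset C c -> oset U (x + c).
Proof. by move=> Ux Cc; have /cone_openP [_] := opens_open U; apply. Qed.

Lemma interior_preimage (phi : V -> V) (A B : set V) (x : V) :
  continuous phi -> (forall y, A (phi y) -> B y) -> A° (phi x) -> B° x.
Proof.
move=> cphi AB Ax; have : nbhs x (phi @^-1` A) := cphi x A Ax.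
by apply: filterS => y; exact: AB.
Qed.

Lemma interior_shift (A B : set V) (w x : V) :
  (forall y, A y -> B (y + w)) -> A° x -> B° (x + w).
Proof.
move=> AB Ax; apply: (@interior_preimage (fun y => y - w) A).
- move=> y; apply: (@continuousB _ _ _ id (cst w)); first exact: cvg_id.
  exact: cvg_cst.
- by move=> y /AB; rewrite subrK.
- by rewrite addrK.
Qed.

Lemma interior_cone_scale (a : R) (w : V) :
  0 < a -> (cset C)° w -> (cset C)° (a *: w).
Proof.
move=> a0 Cw; apply: (@interior_preimage (fun y => a^-1 *: y) (cset C)).
- exact: scaler_continuous.
- by move=> y /(cone_scale a0); rewrite scalerA divff ?scale1r ?gt_eqF.
- by rewrite scalerA mulVf ?scale1r ?gt_eqF.
Qed.

Lemma interior_antipode (w : V) : (antipode C)° w -> (cset C)° (- w).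
Proof.
move=> Cw; apply: (@interior_preimage -%R (antipode C)).
- exact: opp_continuous.
- by move=> y [z Cz /oppr_inj <-].
- by rewrite opprK.
Qed.

Lemma interior_open (U : opens Xa) : open (interior (U : set V) : set Xg).
Proof.
rewrite open_coneE; apply/cone_openP; split; first exact: open_interior.
move=> x c Ux Cc; apply: interior_shift Ux => y Uy.
exact: (cone_opens_add (U := U)).
Qed.

(** Gamma-open sets are produced from Alexandrov-open ones by taking the interior,
    which is still stable under addition of elements of the cone. *)
Definition interior_opens (U : opens Xa) : opens Xg := Opens (interior_open U).

Local Notation beta_open U := (preimage_opens (@beta_continuous R V C) U).

Lemma interior_opens_sub (U : opens Xa) : beta_open (interior_opens U) `<=` U.
Proof. by move=> x; exact: (@interior_subset V). Qed.

(** x - w + gamma is contained in U, and x is an interior point of it. *)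
Lemma interior_opensP (U : opens Xa) (x w : V) :
  oset U (x - w) -> (cset C)° w -> oset (interior_opens U) x.
Proof.
move=> Ux Cw; rewrite -[x](subrK w) addrC.
apply: interior_shift Cw => c Cc; rewrite addrC.
exact: (cone_opens_add (U := U)).
Qed.

Lemma interior_opensS (U W : opens Xa) :
  W `<=` U -> interior_opens W `<=` interior_opens U.
Proof. by move=> WU x; exact: (@filterS V (nbhs (x : V)) _ _ _ WU). Qed.

(** Moving x slightly backwards along an interior direction of the cone stays in
    the open set U. So an Alexandrov neighbourhood of y contains, in its interior,
    the given point x. *)
Lemma interior_opens_cover (U : opens Xg) (x : V) :
  oset U x -> exists2 y : V, oset U y & (cset C)° (x - y).
Proof.
move=> Ux; have [w Cw] := cone_interior C.
have /(nbhs_ballP 0) [e /= e0 eU] : nbhs (0 : R) [set a : R | oset U (x - a *: w)].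
  have c : {for 0, continuous (fun a : R => x - a *: w)}.
    apply: (@continuousB _ _ _ (cst x) (fun a : R => a *: w)).
      exact: cvg_cst.
    exact: scalel_continuous.
  apply: c; rewrite scale0r subr0; apply: open_nbhs_nbhs; split=> //.
  by have /cone_openP [] : cone_open Gamma C U := opens_open U.
exists (x - (e / 2) *: w).
  apply: eU; rewrite /ball /= sub0r normrN gtr0_norm ?divr_gt0//.
  by rewrite ltr_pdivrMr// ltr_pMr// ltr1n.
by rewrite subKr; apply: interior_cone_scale => //; rewrite divr_gt0.
Qed.

(** beta_* is exact although beta is not a homeomorphism: to solve a local problem
    at x in the gamma-topology, solve it for the Alexandrov topology at a point y
    with x - y interior to the cone, and restrict the solution to the interior of
    its domain, which contains x. *)
Lemma beta_qis (k : fieldType) (F G : complex k Xa) (w : complex_hom F G) :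
  quasi_isomorphism w ->
  quasi_isomorphism (direct_image_complex_hom (@beta_continuous R V C) w).
Proof.
move=> /quasi_isomorphismP qw; apply/quasi_isomorphismP => n.
have [winj wsurj] := qw n; split.
  move=> U s t ds e x Ux; have [y Uy Cxy] := interior_opens_cover Ux.
  have [W [WU [u [Wy eu]]]] := winj (beta_open U) s t ds e y Uy.
  have Zx : oset (interior_opens W) x.
    by apply: interior_opensP Cxy; rewrite subKr.
  exists (interior_opens W), (subset_trans (@interior_opens_sub W) WU),
    (res (@interior_opens_sub W) u); split=> //.
  rewrite -[LHS](res_comp WU (@interior_opens_sub W)) eu.
  exact: (esym (hom_res (cdiff F n) (@interior_opens_sub W) u)).
move=> U t dt x Ux; have [y Uy Cxy] := interior_opens_cover Ux.
have [W [WU [s [u [Wy ds e]]]]] := wsurj (beta_open U) t dt y Uy.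
have Zx : oset (interior_opens W) x.
  by apply: interior_opensP Cxy; rewrite subKr.
exists (interior_opens W), (subset_trans (@interior_opens_sub W) WU),
  (res (@interior_opens_sub W) s), (res (@interior_opens_sub W) u); split=> //.
  by rewrite [LHS]hom_res ds linear0.
rewrite [RHS]hom_res -e linearB /= -hom_res; congr (_ - _).
exact/esym/res_comp.
Qed.

End Cone.

(** * Direct image and translations *)

Section Functors.
Variables (R : realType) (V : normedModType R) (C : cone V) (k : fieldType).

Definition translate_functor (t : cone_topology) (v : V) :
    exact_functor k (cone_space t C) (cone_space t C) :=
  direct_image_functor (direct_image_qis_homeo (k := k)
    (@tau_continuous R V t C v) (@tau_continuous R V t C (- v))
    (@tauK R V t C v) (@tauNK R V t C v)).

Lemma derived_translate (t : cone_topology) (v : V)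
    (F G : complex k (cone_space t C)) (u : derived_hom F G) :
  derived_functor (translate_functor t v) u = translate_hom v u.
Proof. exact: derived_direct_image. Qed.

Definition beta_functor :
    exact_functor k (cone_space Alexandrov C) (cone_space Gamma C) :=
  direct_image_functor (@beta_qis R V C k).

Definition beta_inverse :
    exact_functor k (cone_space Gamma C) (cone_space Alexandrov C) :=
  inverse_functor k (@beta_continuous R V C).

Section BetaTranslate.
Variable v : V.
Local Notation ta := (@tau_continuous R V Alexandrov C v).
Local Notation tg := (@tau_continuous R V Gamma C v).
Local Notation bc := (@beta_continuous R V C).

Lemma beta_translateS (U : opens (cone_space Gamma C)) :
  preimage_opens ta (preimage_opens bc U) `<=`
  preimage_opens bc (preimage_opens tg U).
Proof. by []. Qed.

Lemma beta_translate_res (P : presheaf k (cone_space Alexandrov C))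
    (U W : opens (cone_space Gamma C)) (WU : W `<=` U)
    (s : P (preimage_opens bc (preimage_opens tg U))) :
  res (@beta_translateS W) (res (preimageS bc (preimageS tg WU)) s) =
  res (preimageS ta (preimageS bc WU)) (res (@beta_translateS U) s).
Proof.
have h : preimage_opens ta (preimage_opens bc W) `<=`
    preimage_opens bc (preimage_opens tg U) by move=> x /WU.
by rewrite !(res_comp _ _ h).
Qed.

Lemma beta_translate_diff (F : complex k (cone_space Alexandrov C)) n
    (U : opens (cone_space Gamma C))
    (s : translate v (beta_direct_image F) n U) :
  res (@beta_translateS U) (cdiff (translate v (beta_direct_image F)) n U s) =
  cdiff (beta_direct_image (translate v F)) n U (res (@beta_translateS U) s).
Proof. exact/esym/hom_res. Qed.

(** The two composites are isomorphic but not convertible, because the two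
    preimages carry different proofs of openness. *)
Definition beta_translate (F : complex k (cone_space Alexandrov C)) :
    complex_hom (translate v (beta_direct_image F))
                (beta_direct_image (translate v F)) :=
  @ComplexHom k _ (translate v (beta_direct_image F))
    (beta_direct_image (translate v F))
    (fun n => @PresheafHom k _ (translate v (beta_direct_image F) n)
      (beta_direct_image (translate v F) n)
      (fun U => res (@beta_translateS U)) (@beta_translate_res (F n)))
    (@beta_translate_diff F).

Lemma beta_translate_natural (F G : complex k (cone_space Alexandrov C))
    (u : derived_hom F G) :
  derived_eq
    (dh_comp (dh_map (beta_translate G))
             (translate_hom v (derived_functor beta_functor u)))
    (dh_comp (derived_functor beta_functor (translate_hom v u))
             (dh_map (beta_translate F))).
Proof.
have := @derived_natural k _ _
  (comp_functor (translate_functor Gamma v) beta_functor)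
  (comp_functor beta_functor (translate_functor Alexandrov v)) beta_translate.
move=> /(_ _ F G u); rewrite !derived_functor_comp !derived_translate; apply.
move=> F' G' f; apply: complex_hom_ext => n U s.
exact: (esym (hom_res (f n) (@beta_translateS U) s)).
Qed.

End BetaTranslate.

Lemma beta_translate2 (v : V) (F : complex k (cone_space Alexandrov C)) :
  complex_comp (beta_translate v (translate v F))
    (complex_comp (direct_image_complex_hom (@tau_continuous R V Gamma C v)
                     (beta_translate v F))
                  (translate2 v (beta_direct_image F))) =
  complex_comp (direct_image_complex_hom (@beta_continuous R V C)
                  (translate2 v F))
               (beta_translate (v *+ 2) F).
Proof.
apply: complex_hom_ext => n U s; exact: (@res_res3 k _ (F n)).
Qed.

End Functors.

Section BetaInterleaved.
Variables (R : realType) (V : normedModType R) (C : cone V) (k : fieldType).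
Variables (v : V) (F G : complex k (cone_space Alexandrov C)).
Variables (f : derived_hom (translate v F) G) (g : derived_hom (translate v G) F).
Local Notation L := (@beta_functor R V C k).

(** Naturality of [beta_translate] moves it to the right of the word, where
    [beta_translate2] exchanges it with the doubling isomorphism of translations;
    what remains is the image under beta_* of the given equality. *)
Lemma beta_composite (C2v : antipode C (v *+ 2)) :
  derived_eq (dh_comp (dh_comp g (translate_hom v f)) (dh_map (translate2 v F)))
             (dh_map (chi C2v F)) ->
  derived_eq
    (dh_comp (dh_comp (dh_comp (derived_functor L g) (dh_map (beta_translate v G)))
        (translate_hom v
          (dh_comp (derived_functor L f) (dh_map (beta_translate v F)))))
      (dh_map (translate2 v (beta_direct_image F))))
    (dh_map (chi C2v (beta_direct_image F))).
Proof.
move=> /(derived_functor_eq L) /= fg.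
rewrite -!de_assoc de_map (de_assoc (dh_map (beta_translate v G))).
rewrite beta_translate_natural -de_assoc de_map beta_translate2 -de_map.
rewrite !de_assoc fg de_map.
have -> // : complex_comp (ef_map L (chi C2v F)) (beta_translate (v *+ 2) F) =
  chi C2v (beta_direct_image F).
apply: complex_hom_ext => n U s; apply: (@res_comp k _ (F n)).
Qed.

End BetaInterleaved.

Lemma beta_interleaved (R : realType) (V : normedModType R) (C : cone V)
    (k : fieldType) (v : V) (F G : complex k (cone_space Alexandrov C)) :
  interleaved v F G ->
  interleaved v (beta_direct_image F) (beta_direct_image G).
Proof.
move=> [Cv [f [g [fg gf]]]]; exists Cv.
exists (dh_comp (derived_functor (@beta_functor R V C k) f)
  (dh_map (beta_translate v F))).
exists (dh_comp (derived_functor (@beta_functor R V C k) g)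
  (dh_map (beta_translate v G))).
by split; exact: beta_composite.
Qed.

(** * Restriction to the interior of a translate *)

Section InteriorRestriction.
Variables (R : realType) (V : normedModType R) (C : cone V) (k : fieldType).
Variables (e d : V) (Ced : (cset C)° (d - e)).
Local Notation Xa := (cone_space Alexandrov C).
Local Notation Xg := (cone_space Gamma C).
Local Notation bc := (@beta_continuous R V C).
Local Notation ta v := (@tau_continuous R V Alexandrov C v).
Local Notation tg v := (@tau_continuous R V Gamma C v).
Local Notation inner U := (interior_opens (preimage_opens (ta (e - d)) U)).

Lemma sub_inner (U : opens Xa) : U `<=` preimage_opens bc (inner U).
Proof.
move=> x Ux; apply: interior_opensP Ced => /=.
by rewrite /tau -(opprB d e) opprK subrK.
Qed.

Lemma inner_sub (U : opens Xa) :
  preimage_opens bc (preimage_opens (tg d) (inner U)) `<=`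
  preimage_opens (ta e) U.
Proof.
move=> x /interior_opens_sub /=; rewrite /tau.
by have -> : x - d - (e - d) = x - e by rewrite opprB addrA subrK.
Qed.

Section Presheaf.
Variable P : presheaf k Xa.
Local Notation target :=
  (direct_image_presheaf (tg d) (direct_image_presheaf bc P)).

(** P(U + e) -> P(W + d) with W the interior of U + e - d. As W contains U, the
    restricted section defines a germ at every point of U, that is, a section of
    the inverse image over U. *)
Definition inner_germs (U : opens Xa) (s : P (preimage_opens (ta e) U)) :
    inverse_sections bc target U :=
  section_germs (P := target) (@sub_inner U) (res (@inner_sub U) s).

Lemma inner_germs_linear U : linear (@inner_germs U).
Proof. by move=> a s t; rewrite /inner_germs !linearP. Qed.

HB.instance Definition _ U := GRing.isLinear.Build k
  (P (preimage_opens (ta e) U)) (inverse_sections bc target U) *:%R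
  (@inner_germs U) (@inner_germs_linear U).

Lemma inner_germs_res (U W : opens Xa) (WU : W `<=` U)
    (s : P (preimage_opens (ta e) U)) :
  inner_germs (res (preimageS (ta e) WU) s) = inverse_res WU (inner_germs s).
Proof.
rewrite (inverse_res_section _ _ (subset_trans WU (@sub_inner U))).
have h : inner W `<=` inner U.
  by apply: interior_opensS; exact: preimageS.
rewrite -(section_germs_res _ (@sub_inner W) h); congr section_germs.
exact: (@res_res2 k _ P).
Qed.

Definition inner_germs_hom :
    presheaf_hom (direct_image_presheaf (ta e) P)
      (inverse_presheaf bc target) :=
  @PresheafHom k Xa (direct_image_presheaf (ta e) P)
    (inverse_presheaf bc target) (fun U => @inner_germs U) inner_germs_res.

End Presheaf.

Lemma inner_germs_natural (P Q : presheaf k Xa) (g : presheaf_hom P Q)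
    (U : opens Xa) (s : P (preimage_opens (ta e) U)) :
  inner_germs (g _ s) =
  inverse_map (direct_image_hom (tg d) (direct_image_hom bc g)) (inner_germs s).
Proof. by rewrite inverse_map_section /inner_germs -hom_res. Qed.

Definition inner_germs_complex (F : complex k Xa) :
    complex_hom (translate e F)
      (inverse_complex bc (translate d (beta_direct_image F))) :=
  @ComplexHom k Xa (translate e F)
    (inverse_complex bc (translate d (beta_direct_image F)))
    (fun n => inner_germs_hom (F n))
    (fun n U s => inner_germs_natural (cdiff F n) s).

Section Shift.
Variable H : presheaf k Xg.
Local Notation target := (direct_image_presheaf (tg d) H).

Lemma shift_mem (x : Xa) (Z : opens Xg) :
  oset Z (beta (tau (- e) x)) -> oset (preimage_opens (tg (- d)) Z) x.
Proof.
rewrite /= /tau /beta !opprK => Zx.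
have -> : (x : V) + d = (x + e) + (d - e) by rewrite addrACA subrr addr0.
exact: cone_opens_add Zx (interior_subset Ced).
Qed.

Lemma shift_sub (Z : opens Xg) :
  preimage_opens (tg d) (preimage_opens (tg (- d)) Z) `<=` Z.
Proof. by move=> x; rewrite /= tauK. Qed.

Lemma shift_res (Z W : opens Xg) (WZ : W `<=` Z) (s : H Z) :
  res (@shift_sub W) (res WZ s) =
  res (preimageS (tg d) (preimageS (tg (- d)) WZ)) (res (@shift_sub Z) s).
Proof. exact: res_res2. Qed.

(** A germ at x + e is represented on some Z, which then also contains
    x + d = (x + e) + (d - e). A section of H on Z is a section of the translate
    of H by d on Z - d, which contains x. *)
Definition shift_germ (x : Xa) :
    {linear stalk H (beta (tau (- e) x)) -> stalk target x} :=
  @stalk_transport k Xg Xg H target (beta (tau (- e) x)) x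
    (preimage_opens (tg (- d))) (fun Z W WZ => preimageS (tg (- d)) WZ)
    (@shift_mem x) (fun Z => res (@shift_sub Z)) shift_res.

Lemma shift_germE (x : Xa) (Z : opens Xg) (Ze : oset Z (beta (tau (- e) x)))
    (Zd : oset (preimage_opens (tg (- d)) Z) x) (s : H Z) :
  shift_germ x (germ Ze s) = germ (P := target) Zd (res (@shift_sub Z) s).
Proof.
rewrite (Prop_irrelevance Zd (shift_mem Ze)).
exact: (@stalk_transportE _ _ _ H target).
Qed.

Lemma tau_mem (U : opens Xa) (x : Xa) :
  oset U x -> oset (preimage_opens (ta e) U) (tau (- e) x).
Proof. by move=> Ux; rewrite /= tauNK. Qed.

Lemma shift_germs_local (U : opens Xa)
    (s : inverse_sections bc H (preimage_opens (ta e) U)) :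
  @locally_germ k Xa Xg (@beta R V C) bc target U
    (fun x => shift_germ (sval x) (germ_at s (tau_mem (proj2_sig x)))).
Proof.
move=> x Ux; have [N [NU [Z [NZ [t [Nx est]]]]]] := inverse_local s (tau_mem Ux).
have N'U : preimage_opens (ta (- e)) N `<=` U.
  by move=> y /NU; rewrite /= tauNK.
have N'Z : preimage_opens (ta (- e)) N `<=`
    preimage_opens bc (preimage_opens (tg (- d)) Z).
  by move=> y /NZ; exact: shift_mem.
exists (preimage_opens (ta (- e)) N), N'U, (preimage_opens (tg (- d)) Z), N'Z.
exists (res (@shift_sub Z) t); split=> // y Ny /=.
rewrite -(germ_at_res NU s Ny) est.
rewrite (germ_at_section NZ Ny (NZ _ Ny : oset Z (beta (tau (- e) y)))).
exact: shift_germE.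
Qed.

Definition shift_germs (U : opens Xa)
    (s : inverse_sections bc H (preimage_opens (ta e) U)) :
    inverse_sections bc target U :=
  @family_sections k Xa Xg (@beta R V C) bc target U
    (fun x Ux => shift_germ x (germ_at s (tau_mem Ux))) (shift_germs_local s).

Lemma shift_germs_linear U : linear (@shift_germs U).
Proof. by move=> a s t; apply: inverse_ext => x Ux; exact: linearP. Qed.

HB.instance Definition _ U := GRing.isLinear.Build k
  (inverse_sections bc H (preimage_opens (ta e) U)) (inverse_sections bc target U)
  *:%R (@shift_germs U) (@shift_germs_linear U).

Lemma germ_at_shift (U : opens Xa)
    (s : inverse_sections bc H (preimage_opens (ta e) U)) (x : Xa)
    (Ux : oset U x) (Ux' : oset (preimage_opens (ta e) U) (tau (- e) x)) :
  germ_at (shift_germs s) Ux = shift_germ x (germ_at s Ux').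
Proof. by rewrite (Prop_irrelevance Ux' (tau_mem Ux)). Qed.

Lemma shift_germs_res (U W : opens Xa) (WU : W `<=` U)
    (s : inverse_sections bc H (preimage_opens (ta e) U)) :
  shift_germs (inverse_res (preimageS (ta e) WU) s) =
  inverse_res WU (shift_germs s).
Proof.
apply: inverse_ext => x Wx.
rewrite (germ_at_res _ _ _ (WU x Wx)) (germ_at_shift _ _ (tau_mem Wx)).
rewrite (germ_at_shift _ _ (tau_mem (WU x Wx))).
by rewrite (germ_at_res _ _ _ (tau_mem (WU x Wx))).
Qed.

Definition shift_germs_hom :
    presheaf_hom (direct_image_presheaf (ta e) (inverse_presheaf bc H))
      (inverse_presheaf bc target) :=
  @PresheafHom k Xa (direct_image_presheaf (ta e) (inverse_presheaf bc H))
    (inverse_presheaf bc target) (fun U => @shift_germs U) shift_germs_res.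

Lemma shift_germs_section (U : opens Xa) (Z : opens Xg)
    (UZ : preimage_opens (ta e) U `<=` preimage_opens bc Z)
    (UZ' : U `<=` preimage_opens bc (preimage_opens (tg (- d)) Z)) (t : H Z) :
  shift_germs (section_germs UZ t) =
  section_germs (P := target) UZ' (res (@shift_sub Z) t).
Proof.
apply: inverse_ext => x Ux; rewrite (germ_at_shift _ _ (tau_mem Ux)).
rewrite (germ_at_section UZ _ (UZ _ (tau_mem Ux) : oset Z (beta (tau (- e) x)))).
exact: shift_germE.
Qed.

End Shift.

Lemma shift_germs_natural (H K : presheaf k Xg) (g : presheaf_hom H K)
    (U : opens Xa) (s : inverse_sections bc H (preimage_opens (ta e) U)) :
  shift_germs (inverse_map g s) =
  inverse_map (direct_image_hom (tg d) g) (shift_germs s).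
Proof.
apply: inverse_ext => x Ux; rewrite (germ_at_shift _ _ (tau_mem Ux)).
rewrite -[RHS]/(stalk_map _ _ (germ_at _ Ux)) (germ_at_shift _ _ (tau_mem Ux)).
rewrite -[germ_at (inverse_map _ _) _]/(stalk_map g _ (germ_at s _)).
have [Z [Ze [t ->]]] := germ_surj (germ_at s (tau_mem Ux)).
rewrite stalk_mapE !(shift_germE _ (shift_mem Ze)) stalk_mapE.
congr (germ _ _); exact: (esym (hom_res g (@shift_sub Z) t)).
Qed.

Definition shift_germs_complex (H : complex k Xg) :
    complex_hom (translate e (inverse_complex bc H))
      (inverse_complex bc (translate d H)) :=
  @ComplexHom k Xa (translate e (inverse_complex bc H))
    (inverse_complex bc (translate d H))
    (fun n => shift_germs_hom (H n))
    (fun n U s => shift_germs_natural (cdiff H n) s).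

(** This is where an arbitrary morphism of the derived category of the
    gamma-topology is moved past a translation. *)
Lemma shift_germs_derived (H K : complex k Xg) (u : derived_hom H K) :
  derived_eq
    (dh_comp (dh_map (shift_germs_complex K))
             (translate_hom e (derived_functor (@beta_inverse R V C k) u)))
    (dh_comp (derived_functor (@beta_inverse R V C k) (translate_hom d u))
             (dh_map (shift_germs_complex H))).
Proof.
have := @derived_natural k _ _
  (comp_functor (@translate_functor R V C k Alexandrov e) (@beta_inverse R V C k))
  (comp_functor (@beta_inverse R V C k) (@translate_functor R V C k Gamma d))
  shift_germs_complex.
move=> /(_ _ H K u); rewrite !derived_functor_comp !derived_translate; apply.
move=> H' K' g; apply: complex_hom_ext => n U s.
exact: (shift_germs_natural (g n) s).
Qed.

End InteriorRestriction.

(** * Lifting interleavings along the direct image *)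

Section Coherence.
Variables (R : realType) (V : normedModType R) (C : cone V) (k : fieldType).
Variables (e d : V) (Ced : (cset C)° (d - e)).
Local Notation Xa := (cone_space Alexandrov C).
Local Notation Xg := (cone_space Gamma C).
Local Notation bc := (@beta_continuous R V C).
Local Notation ta v := (@tau_continuous R V Alexandrov C v).
Local Notation tg v := (@tau_continuous R V Gamma C v).

(** Near x + e, s is given by one section a, and the counit sends s to a section
    which restricts to a there. On the interior of the displaced neighbourhood
    both sides are therefore restrictions of a. *)
Lemma inner_germs_counit (P : sheaf k Xa) (U : opens Xa)
    (s : inverse_sections bc (direct_image bc P) (preimage_opens (ta e) U)) :
  inner_germs Ced (counit s) = shift_germs Ced s.
Proof.
apply: inverse_ext => x Ux.
rewrite (germ_at_shift Ced s Ux (tau_mem e Ux)).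
have [N [NU [Z [NZ [a [Nx esa]]]]]] := inverse_local s (tau_mem e Ux).
rewrite -(germ_at_res NU s Nx) esa.
rewrite (germ_at_section NZ Nx (NZ _ Nx : oset Z (beta (tau (- e) x)))).
rewrite (shift_germE _ _ (shift_mem Ced (NZ _ Nx : oset Z (beta (tau (- e) x))))).
(* N - d contains x - (d - e), hence x is interior to it *)
pose I := interior_opens (preimage_opens (ta (- d)) N).
have Ix : oset I x.
  apply: interior_opensP Ced; move: Nx; rewrite /= /tau !opprK opprB.
  by rewrite addrA subrK.
have IU : I `<=` interior_opens (preimage_opens (ta (e - d)) U).
  apply: interior_opensS => y /NU; rewrite /= /tau opprK opprB.
  by rewrite addrA.
have IZ : I `<=` preimage_opens (tg (- d)) Z.
  by move=> y /interior_opens_sub /NZ.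
have JN : preimage_opens bc (preimage_opens (tg d) I) `<=` N.
  by move=> y /interior_opens_sub; rewrite /= tauK.
apply/germ_eq; exists I, Ix, IU, IZ.
have e1 : res NU (counit s) = res NZ a.
  by rewrite -counit_res esa counit_section.
exact: (res_common (P := P) JN).
Qed.

Lemma inner_germs_counit_complex (F : complex k Xa) :
  complex_comp (inner_germs_complex Ced F)
    (direct_image_complex_hom (ta e) (counit_complex bc F)) =
  shift_germs_complex Ced (beta_direct_image F).
Proof.
apply: complex_hom_ext => n U s; exact: (inner_germs_counit (P := F n)).
Qed.

Lemma inner_germs_translate2 (C2ed : (cset C)° (d *+ 2 - e *+ 2))
    (F : complex k Xa) :
  complex_comp (shift_germs_complex Ced (translate d (beta_direct_image F)))
    (complex_comp (direct_image_complex_hom (ta e) (inner_germs_complex Ced F))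
                  (translate2 e F)) =
  complex_comp (inverse_complex_hom bc (translate2 d (beta_direct_image F)))
               (inner_germs_complex C2ed F).
Proof.
apply: complex_hom_ext => n U s /=.
rewrite inverse_map_section /=.
set H := (X in inverse_sections bc X U).
pose W1 := interior_opens (preimage_opens (ta (e - d)) (preimage_opens (ta e) U)).
have h1 : U `<=` preimage_opens bc (preimage_opens (tg (- d)) W1).
  move=> x Ux; apply: (shift_mem Ced); exact: (sub_inner Ced (tau_mem e Ux)).
rewrite (shift_germs_section Ced _ h1).
pose W2 := interior_opens (preimage_opens (ta (e *+ 2 - d *+ 2)) U).
have I1 : opensI (preimage_opens (tg (- d)) W1) W2 `<=`
  preimage_opens (tg (- d)) W1 by move=> ? [].
have I2 : opensI (preimage_opens (tg (- d)) W1) W2 `<=` W2 by move=> ? [].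
(* both families are the germs of restrictions of s, compared on the common
   domain *)
apply: (@section_germs_eq _ _ _ _ _ _ _ _ _ _ _ _ _ I1 I2).
  by move=> x Ux; split; [exact: h1 | exact: (sub_inner C2ed Ux)].
exact: (@res_res43 k _ (F n)).
Qed.

Lemma counit_chi (Cd : antipode C d) (Ce : antipode C e) (F : complex k Xa) :
  complex_comp
    (complex_comp (counit_complex bc F)
                  (inverse_complex_hom bc (chi Cd (beta_direct_image F))))
    (inner_germs_complex Ced F) = chi Ce F.
Proof.
apply: complex_hom_ext => n U s /=.
rewrite inverse_map_section /=.
rewrite [LHS](counit_section (F := F n)) .
exact: (@res_comp3 k _ (F n)).
Qed.
End Coherence.

Section InnerComposite.
Variables (R : realType) (V : normedModType R) (C : cone V) (k : fieldType).
Variables (e d : V) (Ced : (cset C)° (d - e)).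
Variables (F G : complex k (cone_space Alexandrov C)).
Local Notation M := (@beta_inverse R V C k).
Local Notation bc := (@beta_continuous R V C).

Definition lift_interleaving (F G : complex k (cone_space Alexandrov C))
    (f : derived_hom (translate d (beta_direct_image F)) (beta_direct_image G)) :
    derived_hom (translate e F) G :=
  dh_comp (dh_map (counit_complex bc G))
    (dh_comp (derived_functor M f) (dh_map (inner_germs_complex Ced F))).

Variable f :
  derived_hom (translate d (beta_direct_image F)) (beta_direct_image G).
Variable g :
  derived_hom (translate d (beta_direct_image G)) (beta_direct_image F).

(** In the middle of the composite of the two lifts, the counit of G meets the
    inner restriction of G, which gives [shift_germs_complex]; by its naturality
    the image of f moves to the left, next to the image of g. The hypothesis then
    applies inside the functor M, and [counit_chi] ends the computation. *)
Lemma lift_composite (C2ed : (cset C)° (d *+ 2 - e *+ 2))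
    (C2d : antipode C (d *+ 2)) (C2e : antipode C (e *+ 2)) :
  derived_eq (dh_comp (dh_comp g (translate_hom d f))
                      (dh_map (translate2 d (beta_direct_image F))))
             (dh_map (chi C2d (beta_direct_image F))) ->
  derived_eq (dh_comp (dh_comp (lift_interleaving g)
                               (translate_hom e (lift_interleaving f)))
                      (dh_map (translate2 e F)))
             (dh_map (chi C2e F)).
Proof.
move=> /(derived_functor_eq M) /= fg; rewrite /lift_interleaving /=.
rewrite -!de_assoc de_map (de_assoc (dh_map (inner_germs_complex Ced G))).
rewrite de_map inner_germs_counit_complex.
rewrite (de_assoc (dh_map (shift_germs_complex _ _))) shift_germs_derived.
rewrite -de_assoc de_map (inner_germs_translate2 _ C2ed) -de_map.
rewrite (de_assoc _ (dh_map (ef_map M _))).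
rewrite !(de_assoc _ _ (dh_map (inner_germs_complex _ _))).
rewrite (de_assoc (derived_functor M g)) fg !de_map.
by rewrite (counit_chi C2ed C2d C2e).
Qed.

End InnerComposite.

Lemma interleaved_of_beta (R : realType) (V : normedModType R) (C : cone V)
    (k : fieldType) (e d : V) (F G : complex k (cone_space Alexandrov C)) :
  antipode C e -> (cset C)° (d - e) ->
  interleaved d (beta_direct_image F) (beta_direct_image G) ->
  interleaved e F G.
Proof.
move=> Ce Ced [Cd [f [g [fg gf]]]].
have C2ed : (cset C)° (d *+ 2 - e *+ 2).
  by rewrite -mulrnBl -scaler_nat; exact: interior_cone_scale.
exists Ce, (lift_interleaving Ced f), (lift_interleaving Ced g).
by split; [exact: lift_composite fg | exact: lift_composite gf].
Qed.

Theorem theorem4p21 (R : realType) (V : normedModType R)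
    (fdV : finite_dimensional V) (gamma : cone V) (k : fieldType)
    (v : V) (Iv : (antipode gamma)° v)
    (F G : complex k (cone_space Alexandrov gamma)) :
  interleaving_distance v F G =
  interleaving_distance v (beta_direct_image F) (beta_direct_image G).
Proof.
apply/eqP; rewrite eq_le; apply/andP; split; last first.
  apply: ereal_inf_le_tmp => _ [[c [c0 cFG] <-]|->]; last by right.
  by left; exists c => //; split=> //; exact: beta_interleaved.
apply: le_ereal_inf_tmp => _ [[c [c0 cFG] <-]|->]; last exact: leey.
(* the lifted interleaving costs an arbitrarily small increase a of c *)
apply/lee_addgt0Pr => a a0; apply: ereal_inf_lbound; left.
exists (c + a) => //; split; first by rewrite addr_ge0// ltW.
apply: interleaved_of_beta cFG.
  have [w gw <-] := interior_subset Iv.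
  exists ((c + a) *: w); last by rewrite scalerN.
  by apply: cone_scale => //; rewrite ltr_wpDl.
rewrite scalerDl opprD addrA subrr add0r -scalerN.
by apply: interior_cone_scale => //; exact: interior_antipode.
Qed.
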